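(* Let $1<p<\infty$ and let $T$ be a Kreiss bounded operator on the complex space $L^p(\Omega,\mu)$, where $(\Omega,\mu)$ is a measure space. Then $\|T^n\|=O\big(n/\sqrt{\log n}\big)$ as $n\to\infty$.
   Context: A bounded linear operator $T$ on a complex Banach space is Kreiss bounded if there is $C>0$ such that, for every $\lambda\in\mathbb{C}$ with $|\lambda|>1$, $\lambda I-T$ is invertible and $\|(\lambda I-T)^{-1}\|\le\frac{C}{|\lambda|-1}$. *)

(* Defs.v *)
From HB Require Import structures.
From mathcomp Require Import all_boot all_order all_algebra.
From mathcomp Require Import ring_quotient.
From mathcomp Require Import complex.
From mathcomp Require Import all_classical all_reals all_analysis.
From mathcomp Require Import measurable_realfun.

Set Implicit Arguments.
Unset Strict Implicit.
Unset Printing Implicit Defensive.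
Import Order.TTheory GRing.Theory Num.Theory.
Import numFieldNormedType.Exports.

Local Open Scope classical_set_scope.
Local Open Scope ring_scope.
Local Open Scope quotient_scope.
Local Open Scope complex_scope.

Local Notation Re := complex.Re.
Local Notation Im := complex.Im.

(* Norms over [R[i]] take their values in [R[i]], on its nonnegative real
   axis; [rnorm] is the same norm as an element of [R]. *)
Definition rnorm (R : realType) (V : normedZmodType R[i]) (x : V) : R :=
  Re `|x|.

Section rnorm_theory.
Context {R : realType} {V : normedZmodType R[i]}.
Implicit Types x y : V.

Lemma rnormE x : (rnorm x)%:C = `|x|.
Proof.
have /ger0_Im : 0 <= `|x| := normr_ge0 x.
by rewrite /rnorm; case: `|x| => a b /= ->.
Qed.

Lemma rnorm_ge0 x : 0 <= rnorm x.
Proof. by rewrite -ler0c rnormE. Qed.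

Lemma rnormD x y : rnorm (x + y) <= rnorm x + rnorm y.
Proof. by rewrite -lecR rmorphD /= !rnormE ler_normD. Qed.

Lemma rnorm0_eq0 x : rnorm x = 0 -> x = 0.
Proof. by move=> x0; apply/eqP; rewrite -normr_eq0 -rnormE x0. Qed.

Lemma rnorm0 : rnorm (0 : V) = 0.
Proof. by apply: complexI; rewrite rnormE normr0. Qed.

End rnorm_theory.

Lemma rnormM (R : realType) (a b : R[i]) : rnorm (a * b) = rnorm a * rnorm b.
Proof. by apply: complexI; rewrite rmorphM /= !rnormE normrM. Qed.

Section complex_measurable.
Context d (T : measurableType d) (R : realType).
Implicit Types f g : T -> R[i].

(* The library has no sigma-algebra on [R[i]]. *)
Definition cmeasurable_fun f : Prop :=
  measurable_fun setT (fun x => Re (f x)) /\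
  measurable_fun setT (fun x => Im (f x)).

Lemma cmeasurable_rnorm f : cmeasurable_fun f ->
  measurable_fun setT (fun x => rnorm (f x)).
Proof.
case=> mr mi.
have -> : (fun x => rnorm (f x)) =
    (fun x => Num.sqrt (Re (f x) ^+ 2 + Im (f x) ^+ 2)).
  by apply/funext => x; rewrite /rnorm normc_def.
apply: (@measurableT_comp _ _ _ _ _ _ (@Num.sqrt R)).
  exact: continuous_measurable_fun (@sqrt_continuous R).
by apply: measurable_funD; apply: measurable_funX.
Qed.

Lemma cmeasurable_cst (c : R[i]) : cmeasurable_fun (fun=> c).
Proof. by split; exact: measurable_cst. Qed.

Lemma cmeasurableD f g : cmeasurable_fun f -> cmeasurable_fun g ->
  cmeasurable_fun (fun x => f x + g x).
Proof.
move=> [fr fi] [gr gi]; split.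
- rewrite (_ : (fun x => _) = (fun x => Re (f x) + Re (g x))).
    exact: measurable_funD.
  by apply/funext => x; case: (f x) (g x) => [? ?] [? ?].
- rewrite (_ : (fun x => _) = (fun x => Im (f x) + Im (g x))).
    exact: measurable_funD.
  by apply/funext => x; case: (f x) (g x) => [? ?] [? ?].
Qed.

Lemma cmeasurableM f g : cmeasurable_fun f -> cmeasurable_fun g ->
  cmeasurable_fun (fun x => f x * g x).
Proof.
move=> [fr fi] [gr gi]; split.
- rewrite (_ : (fun x => _) =
      (fun x => Re (f x) * Re (g x) - Im (f x) * Im (g x))).
    by apply: measurable_funB; exact: measurable_funM.
  by apply/funext => x; case: (f x) (g x) => [? ?] [? ?].
- rewrite (_ : (fun x => _) =
      (fun x => Re (f x) * Im (g x) + Im (f x) * Re (g x))).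
    by apply: measurable_funD; exact: measurable_funM.
  by apply/funext => x; case: (f x) (g x) => [? ?] [? ?].
Qed.

End complex_measurable.

Section complex_Lnorm.
Context d (T : measurableType d) (R : realType).
Variables (mu : {measure set T -> \bar R}) (p : R).
Implicit Types f g : T -> R[i].

Definition cLnorm f : \bar R := 'N[mu]_p%:E[EFin \o (fun x => rnorm (f x))]%E.

Hypothesis p1 : 1 <= p.

Let p0 : 0 < p. Proof. exact: lt_le_trans p1. Qed.

Lemma cLnorm_ge0 f : (0 <= cLnorm f)%E.
Proof. exact: Lnorm_ge0. Qed.

Lemma cLnorm0 : cLnorm (fun=> 0) = 0%E.
Proof.
rewrite /cLnorm; under [X in Lnorm _ _ X]eq_fun do rewrite rnorm0.
by apply: Lnorm0; rewrite eqe gt_eqF.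
Qed.

Let measurable_Lnorm (f : T -> R) : measurable_fun setT f ->
  measurable_fun setT (fun x => `|(EFin \o f) x| `^ p)%E.
Proof.
move=> mf; apply: (measurableT_comp (measurable_poweR _)) => //.
by apply: measurableT_comp => //; exact/measurable_EFinP.
Qed.

Lemma le_Lnorm (f g : T -> R) :
    measurable_fun setT f -> measurable_fun setT g ->
    (forall x, `|f x| <= `|g x|) ->
  ('N[mu]_p%:E[EFin \o f] <= 'N[mu]_p%:E[EFin \o g])%E.
Proof.
move=> mf mg fg; rewrite unlock gt0_ler_poweR ?invr_ge0 ?(ltW p0)//.
- by rewrite in_itv/= leey andbT integral_ge0.
- by rewrite in_itv/= leey andbT integral_ge0.
- apply: ge0_le_integral => //.
  + by move=> x _; exact: poweR_ge0.
  + exact: measurable_Lnorm.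
  + exact: measurable_Lnorm.
  + move=> x _; rewrite /= lee_fin.
    by rewrite ge0_ler_powR ?(ltW p0)// nnegrE.
Qed.

Lemma cLnormD f g : cmeasurable_fun f -> cmeasurable_fun g ->
  (cLnorm (fun x => (f x + g x)%R) <= cLnorm f + cLnorm g)%E.
Proof.
move=> mf mg.
have mF := cmeasurable_rnorm mf; have mG := cmeasurable_rnorm mg.
apply: le_trans (@minkowski_EFin _ _ _ mu _ _ p mF mG p1).
apply: le_Lnorm.
- exact/cmeasurable_rnorm/cmeasurableD.
- exact: measurable_funD.
- by move=> x /=; rewrite !ger0_norm ?addr_ge0 ?rnorm_ge0//; exact: rnormD.
Qed.

Lemma cLnormZ (a : R[i]) f : cmeasurable_fun f ->
  cLnorm (fun x => a * f x) = ((rnorm a)%:E * cLnorm f)%E.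
Proof.
move=> mf; have mF := cmeasurable_rnorm mf.
rewrite /cLnorm unlock.
have ge0 x : [set: T] x -> (0 <= (`|rnorm (f x)| `^ p)%:E)%E.
  by move=> _; rewrite lee_fin powR_ge0.
have -> : (\int[mu]_x `|(EFin \o (fun x => rnorm (a * f x))) x| `^ p =
    (rnorm a `^ p)%:E * \int[mu]_x `|(EFin \o (fun x => rnorm (f x))) x| `^ p)%E.
  rewrite -ge0_integralZl_EFin ?powR_ge0//; last exact: measurable_Lnorm.
  apply: eq_integral => x _ /=.
  by rewrite rnormM normrM (ger0_norm (rnorm_ge0 a)) powRM ?rnorm_ge0// EFinM.
rewrite poweRM ?lee_fin ?powR_ge0//; last exact: integral_ge0.
by rewrite poweR_EFin -powRrM mulfV ?gt_eqF// powRr1 ?rnorm_ge0.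
Qed.

Lemma eq_ae_cLnorm f g : cmeasurable_fun f -> cmeasurable_fun g ->
  {ae mu, forall x, f x = g x} -> cLnorm f = cLnorm g.
Proof.
move=> mf mg fg.
have mF := cmeasurable_rnorm mf; have mG := cmeasurable_rnorm mg.
rewrite /cLnorm unlock; congr (_ `^ _)%E.
apply: ae_eq_integral => //.
- exact: measurable_Lnorm.
- exact: measurable_Lnorm.
- by apply: filterS fg => x fgx _; rewrite /= fgx.
Qed.

Lemma cLnorm_eq0 f : cmeasurable_fun f -> cLnorm f = 0%E ->
  {ae mu, forall x, f x = 0}.
Proof.
move=> mf f0; have mF := cmeasurable_rnorm mf.
have /measurable_EFinP mE := mF.
have := Lnorm_eq0_eq0 mE (_ : (0 < p%:E)%E) f0.
rewrite lte_fin => /(_ p0); apply: filterS => x /(_ I) [].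
exact: rnorm0_eq0.
Qed.

End complex_Lnorm.

Section complex_Lfun.
Context d (T : measurableType d) (R : realType).
Variables (mu : {measure set T -> \bar R}) (p : R).

Definition cLfun : {pred T -> R[i]} :=
  mem [set f : T -> R[i] | cmeasurable_fun f /\ (cLnorm mu p f < +oo)%E].

Lemma cLfunP (f : T -> R[i]) :
  f \in cLfun <-> cmeasurable_fun f /\ (cLnorm mu p f < +oo)%E.
Proof. by split=> [/set_mem//|/mem_set]. Qed.

Variable p1 : 1 <= p.

Lemma cLfun_submod_closed : submod_closed cLfun.
Proof.
split.
  apply/cLfunP; split; first exact: cmeasurable_cst.
  by rewrite [X in (X < _)%E](cLnorm0 mu p1).
move=> a f g /cLfunP[mf lf] /cLfunP[mg lg]; apply/cLfunP.
have maf : cmeasurable_fun (fun x => a * f x).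
  by apply: cmeasurableM => //; exact: cmeasurable_cst.
split; first exact: cmeasurableD.
apply: le_lt_trans (cLnormD mu p1 maf mg) _.
rewrite lte_add_pinfty// cLnormZ// lte_mul_pinfty// ?lee_fin ?rnorm_ge0//.
Qed.

(* The index [1 <= p] does not occur in the fields: it is what makes this type a
   vector space. *)
Record cLfunType (p1' : 1 <= p) := CLfun {
  cLfun_fun :> T -> R[i];
  cLfun_funP : cLfun_fun \in cLfun }.

HB.instance Definition _ := [isSub for @cLfun_fun p1].
HB.instance Definition _ := [Choice of cLfunType p1 by <:].
HB.instance Definition _ := GRing.SubChoice_isSubLmodule.Build _ _ _
  (cLfunType p1) cLfun_submod_closed.

Lemma cLfun_measurable (f : cLfunType p1) : cmeasurable_fun f.
Proof. by have /cLfunP[] := cLfun_funP f. Qed.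

Lemma cLfun_lty (f : cLfunType p1) : (cLnorm mu p f < +oo)%E.
Proof. by have /cLfunP[] := cLfun_funP f. Qed.

Lemma cLfun_fin_num (f : cLfunType p1) : cLnorm mu p f \is a fin_num.
Proof. by rewrite ge0_fin_numE ?cLnorm_ge0// cLfun_lty. Qed.

Definition cLfun_null : {pred cLfunType p1} :=
  mem [set f : cLfunType p1 | {ae mu, forall x, f x = 0}].

Lemma cLfun_nullP (f : cLfunType p1) :
  f \in cLfun_null <-> {ae mu, forall x, f x = 0}.
Proof. by split=> [/set_mem//|/mem_set]. Qed.

Lemma cLfun_null_submod_closed : submod_closed cLfun_null.
Proof.
split; first by apply/cLfun_nullP/nearW.
move=> a f g /cLfun_nullP f0 /cLfun_nullP g0; apply/cLfun_nullP.
apply: filterS2 f0 g0 => x fx gx.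
have a0 : a * 0 + 0 = 0 by rewrite mulr0 addr0.
by rewrite [LHS]/(a * f x + g x) fx gx; exact: a0.
Qed.

HB.instance Definition _ := GRing.isSubmodClosed.Build _ _ cLfun_null
  cLfun_null_submod_closed.

(* The complex L^p space: p-integrable functions modulo equality almost
   everywhere, i.e. modulo the subspace of almost everywhere null functions. *)
Definition cLspace : Type := Quotient.quot cLfun_null.

HB.instance Definition _ := Choice.on cLspace.
HB.instance Definition _ := GRing.Zmodule.on cLspace.
HB.instance Definition _ := EqQuotient.on cLspace.

Lemma cLspaceW (P : cLspace -> Prop) :
  (forall f : cLfunType p1, P (\pi_cLspace f)) -> forall u, P u.
Proof. by move=> Pf u; rewrite -[u]reprK. Qed.

Lemma cLspace_eqP (f g : cLfunType p1) :
  \pi_cLspace f = \pi_cLspace g <-> {ae mu, forall x, f x = g x}.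
Proof.
have E : (\pi_cLspace f == \pi_cLspace g) = (f - g \in cLfun_null).
  exact/esym/Quotient.idealrBE.
split=> [/eqP|] fg.
  move: fg; rewrite E => /cLfun_nullP; apply: filterS => x fgx.
  by apply/eqP; rewrite -subr_eq0; apply/eqP.
apply/eqP; rewrite E; apply/cLfun_nullP; apply: filterS fg => x fgx.
by apply/eqP; rewrite [eqbLHS]/(f x - g x) subr_eq0 fgx.
Qed.

Definition cLspace_scale (a : R[i]) (u : cLspace) : cLspace :=
  \pi_cLspace (a *: repr u).

Lemma cLspace_scaleE a (f : cLfunType p1) :
  cLspace_scale a (\pi_cLspace f) = \pi_cLspace (a *: f).
Proof.
apply/cLspace_eqP; have /cLspace_eqP := reprK (\pi_cLspace f).
by apply: filterS => x fx; exact: (congr1 ( *%R a) fx).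
Qed.

Lemma cLspace_piD (f g : cLfunType p1) :
  \pi_cLspace (f + g) = \pi_cLspace f + \pi_cLspace g.
Proof. by rewrite !piE. Qed.

Lemma cLspace_scaleA a b u :
  cLspace_scale a (cLspace_scale b u) = cLspace_scale (a * b) u.
Proof. by elim/cLspaceW: u => f; rewrite !cLspace_scaleE scalerA. Qed.

Lemma cLspace_scale1 : left_id 1 cLspace_scale.
Proof. by move=> u; elim/cLspaceW: u => f; rewrite !cLspace_scaleE scale1r. Qed.

Lemma cLspace_scaleDr : right_distributive cLspace_scale +%R.
Proof.
move=> a u v; elim/cLspaceW: u => f; elim/cLspaceW: v => g.
by rewrite -cLspace_piD !cLspace_scaleE -cLspace_piD scalerDr.
Qed.

Lemma cLspace_scaleDl u : {morph cLspace_scale^~ u : a b / a + b}.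
Proof.
move=> a b; elim/cLspaceW: u => f.
by rewrite !cLspace_scaleE -cLspace_piD scalerDl.
Qed.

HB.instance Definition _ := GRing.Zmodule_isLmodule.Build R[i] cLspace
  cLspace_scaleA cLspace_scale1 cLspace_scaleDr cLspace_scaleDl.

Lemma cLspace_piZ a (f : cLfunType p1) :
  \pi_cLspace (a *: f) = a *: \pi_cLspace f.
Proof. by rewrite -cLspace_scaleE. Qed.

Definition cLspace_norm (u : cLspace) : R[i] :=
  (fine (cLnorm mu p (repr u : cLfunType p1)))%:C.

Lemma cLspace_normE (f : cLfunType p1) :
  cLspace_norm (\pi_cLspace f) = (fine (cLnorm mu p f))%:C.
Proof.
congr (fine _)%:C; apply: eq_ae_cLnorm; try exact: cLfun_measurable.
by apply/cLspace_eqP; rewrite reprK.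
Qed.

Lemma cLspace_ler_normD u v :
  cLspace_norm (u + v) <= cLspace_norm u + cLspace_norm v.
Proof.
elim/cLspaceW: u => f; elim/cLspaceW: v => g.
rewrite -cLspace_piD !cLspace_normE -rmorphD lecR -fineD ?cLfun_fin_num//.
rewrite fine_le ?fin_numD ?cLfun_fin_num//.
by apply: cLnormD => //; exact: cLfun_measurable.
Qed.

Lemma cLspace_normrZ a u : cLspace_norm (a *: u) = `|a| * cLspace_norm u.
Proof.
elim/cLspaceW: u => f; rewrite -cLspace_piZ !cLspace_normE -rnormE -rmorphM.
congr _%:C; have mf := cLfun_measurable f.
transitivity (fine ((rnorm a)%:E * cLnorm mu p f)).
  by congr fine; rewrite -cLnormZ.
by rewrite fineM ?cLfun_fin_num.
Qed.

Lemma cLspace_normr0_eq0 u : cLspace_norm u = 0 -> u = 0.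
Proof.
elim/cLspaceW: u => f; rewrite cLspace_normE => /complexI f0.
have /cLnorm_eq0 : cLnorm mu p f = 0%E.
  by rewrite -[LHS]fineK ?cLfun_fin_num// f0.
move=> /(_ p1 (cLfun_measurable f)) fae.
have -> : 0 = \pi_cLspace (0 : cLfunType p1) by rewrite !piE.
exact/cLspace_eqP.
Qed.

HB.instance Definition _ := Lmodule_isNormed.Build R[i] cLspace
  cLspace_ler_normD cLspace_normrZ cLspace_normr0_eq0.

Lemma cLspace_rnormE (f : cLfunType p1) :
  rnorm (\pi_cLspace f : cLspace) = fine (cLnorm mu p f).
Proof. by rewrite [LHS]/(Re (cLspace_norm _)) cLspace_normE. Qed.

End complex_Lfun.

Arguments cLspace {d T R} mu {p} p1.

Section operators.
Context {R : realType} {V : normedModType R[i]}.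
Implicit Types (f : V -> V) (A : {linear V -> V}).

Definition bounded_op f : Prop :=
  exists M : R, forall x : V, rnorm (f x) <= M * rnorm x.

(* [sup] is 0 on unbounded sets: this is the operator norm of a [bounded_op]
   only. *)
Definition op_norm f : R :=
  sup [set rnorm (f x) | x in [set x : V | rnorm x <= 1]].

Lemma op_norm_has_sup f : bounded_op f ->
  has_sup [set rnorm (f x) | x in [set x : V | rnorm x <= 1]].
Proof.
move=> [M fM]; split; first by exists (rnorm (f 0)), 0; rewrite //= rnorm0.
exists `|M| => _ [x /= x1 <-]; apply: le_trans (fM x) _.
apply: le_trans (ler_wpM2r (rnorm_ge0 x) (ler_norm M)) _.
by rewrite -[leRHS]mulr1 ler_wpM2l.
Qed.

Lemma op_norm_ub A : bounded_op A ->
  forall x, rnorm (A x) <= op_norm A * rnorm x.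
Proof.
move=> bA x; have [->|x0] := eqVneq x 0; first by rewrite linear0 rnorm0 mulr0.
have nx0 : 0 < rnorm x.
  by rewrite lt0r rnorm_ge0 andbT; apply: contra x0 => /eqP/rnorm0_eq0/eqP.
rewrite -ler_pdivrMr// mulrC.
have rnormZ (y : V) : rnorm (((rnorm x)^-1)%:C *: y) = (rnorm x)^-1 * rnorm y.
  apply: complexI; rewrite rnormE normrZ rmorphM /= !rnormE; congr (_ * _).
  by rewrite ger0_norm// ler0c invr_ge0 ltW.
apply: ub_le_sup; first by case: (op_norm_has_sup bA).
exists (((rnorm x)^-1)%:C *: x); rewrite /= ?linearZ ?rnormZ//=.
by rewrite mulVf// gt_eqF.
Qed.

(* Invertibility is in the algebra of bounded operators: [S] is the bounded
   linear two-sided inverse of [l I - A]. *)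
Definition kreiss_bounded A : Prop :=
  exists2 C : R, 0 < C & forall l : R[i], 1 < rnorm l ->
    exists S : {linear V -> V},
      [/\ bounded_op S,
          cancel (fun x => l *: x - A x) S,
          cancel S (fun x => l *: x - A x) &
          op_norm S <= C / (rnorm l - 1)].

End operators.

(* Main.v *)
From HB Require Import structures.
Require Import Defs.
From mathcomp Require Import all_boot all_order all_algebra.
From mathcomp Require Import all_classical all_reals all_analysis.
From mathcomp Require Import complex ring lra zify ring_quotient measurable_realfun.

(* Idea. On |z| = 1 let R_r(z) = sum_n (r z)^n T^n; the Kreiss condition says
   |R_r(z)| <= C / (1 - r). For 2^j <= N put h_j(z) = 2^-j R_r(z) x with 1 - r of
   order 2^-j, and g_j(z) = h_j(z) - h_j(tau_j z), where tau_j is the rotation by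
   the angle 2 pi 2^-j. The N-th Fourier coefficient of R_s g_j, with 1 - s of
   order 1/N, is a multiple of T^N x by a factor bounded below. Summing over the
   log N values of j,
     (log N) |T^N x| <= C N |sum_j g_j|_{L^2},
   so it suffices that |sum_j g_j|_{L^2} <= C sqrt(log N) |x|. This holds in a
   2-uniformly smooth space, such as L^p with p >= 2, where the duality map J is
   Lipschitz: with S_j = g_0 + ... + g_j, the pairing of J(S_j) with g_j only
   involves J(S_j) - J(S_j o tau_j^-1), and S_j moves little under tau_j.
   For p < 2 the same inequality is applied in L^q, q = p/(p-1), to g_j built from
   functionals norming the blocks of R_s x of frequency at distance 2^j from N.
   The circle is replaced by the M-th roots of unity and R_r by a partial sum with
   many terms, so that all sums are finite. *)

Set Implicit Arguments.
Unset Strict Implicit.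
Unset Printing Implicit Defensive.
Import Order.TTheory GRing.Theory Num.Theory.
Import numFieldNormedType.Exports.
Local Open Scope classical_set_scope.
Local Open Scope ring_scope.
Local Open Scope quotient_scope.
Local Open Scope complex_scope.

Local Notation Re := complex.Re.
Local Notation Im := complex.Im.

(** * Norms and roots of unity *)

(** The Kreiss condition is used as the lower bound (1 - |z|) |x| <= C |x - z T x| for |z| < 1.
    Applied to a partial sum P, for which P - z T P = x - z^K T^K x, it is useful only if |z|^K |T^K
    x| <= |x|. This is a spectral radius estimate; it is derived from the same lower bound by
    continuation in the radius, with finite sums in place of contour integrals. Rotations raise a
    second obstacle: z and tau_j z must leave the same remainder, so K has to be a multiple of the
    order of every tau_j, whence the powers of 2 in the period. The triangle inequality would bound
    the sum of the g_j by a multiple of log N and gain nothing; smoothness brings this down to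
    sqrt(log N). On the other side nothing may cancel between different j: the k-th coefficient of
    g_j carries the factor 1 - tau_j^k, whose real part is nonnegative for all k and at least 1 on
    the middle half of each period. The decay S_j needs is that h_k, of modulus O(1), has Lipschitz
    constant of order 2^k, so that tau_j moves it by 2^(k-j), a geometric series in k. *)

Section real_norm.
Context {R : realType}.

Lemma rnorm_complexE (z : R[i]) : rnorm z = Num.sqrt (Re z ^+ 2 + Im z ^+ 2).
Proof. by rewrite /rnorm normc_def. Qed.

Lemma rnorm_real (r : R) : rnorm (r%:C : R[i]) = `|r|.
Proof. by rewrite rnorm_complexE /= expr0n addr0 sqrtr_sqr. Qed.

Lemma rnorm1 : rnorm (1 : R[i]) = 1.
Proof. by rewrite (rnorm_real 1) normr1. Qed.

Lemma rnormX (z : R[i]) n : rnorm (z ^+ n) = rnorm z ^+ n.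
Proof.
elim: n => [|n IH]; first by rewrite !expr0 rnorm1.
by rewrite !exprS rnormM IH.
Qed.

Lemma rnorm_nat n : rnorm (n%:R : R[i]) = n%:R.
Proof. by rewrite -(rmorph_nat (real_complex R)) rnorm_real normr_nat. Qed.

Lemma Re_le_rnorm (z : R[i]) : Re z <= rnorm z.
Proof.
rewrite rnorm_complexE; apply: le_trans (ler_norm _) _.
by rewrite -sqrtr_sqr ler_wsqrtr// lerDl sqr_ge0.
Qed.

Lemma rnormZ (V : normedModType R[i]) (a : R[i]) (x : V) : rnorm (a *: x) = rnorm a * rnorm x.
Proof. by apply: complexI; rewrite rmorphM /= !rnormE normrZ. Qed.

Context {V : normedZmodType R[i]}.
Implicit Types x y : V.

Lemma rnormN x : rnorm (- x) = rnorm x.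
Proof. by rewrite /rnorm normrN. Qed.

Lemma rnormB x y : rnorm (x - y) <= rnorm x + rnorm y.
Proof. by rewrite -(rnormN y) rnormD. Qed.

Lemma rnorm_distC x y : rnorm (x - y) = rnorm (y - x).
Proof. by rewrite -rnormN opprB. Qed.

Lemma ler_rnorm_sum (I : Type) (r : seq I) (P : pred I) (F : I -> V) :
  rnorm (\sum_(i <- r | P i) F i) <= \sum_(i <- r | P i) rnorm (F i).
Proof.
elim/big_ind2 : _ => //; first by rewrite rnorm0.
by move=> x a y b xa yb; apply: le_trans (rnormD _ _) (lerD _ _).
Qed.

End real_norm.

Section roots_of_unity.
Context {R : realType}.
Implicit Types a b : R.

Definition cis a : R[i] := Complex (cos a) (sin a).

Lemma cisD a b : cis (a + b) = cis a * cis b.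
Proof.
apply/eqP; rewrite eq_complex /= cosD sinD; apply/andP; split => //.
by rewrite addrC.
Qed.

Lemma cis0 : cis 0 = 1.
Proof. by apply/eqP; rewrite eq_complex /= cos0 sin0 !eqxx. Qed.

Lemma cisX a n : cis a ^+ n = cis (a * n%:R).
Proof.
elim: n => [|n IH]; first by rewrite mulr0 cis0 expr0.
by rewrite exprS IH -cisD -{1}[a]mulr1 -mulrDr -natr1 addrC.
Qed.

Lemma rnorm_cis a : rnorm (cis a) = 1.
Proof. by rewrite rnorm_complexE /= cos2Dsin2 sqrtr1. Qed.

Lemma abs_sin_le a : `|sin a| <= `|a|.
Proof.
have pos (x : R) : 0 < x -> `|sin x| <= x.
  move=> x0; have dsin y : y \in `]0, x[%R -> is_derive y 1 sin (cos y).
    by move=> _; exact: is_derive_sin.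
  have csin : {within `[0, x], continuous (@sin R)}.
    by apply: continuous_subspaceT => y; exact: continuous_sin.
  have [c _] := MVT x0 dsin csin; rewrite sin0 !subr0 => ->.
  by rewrite normrM (gtr0_norm x0) ler_piMl ?(ltW x0)// cos_max.
have [a0|a0|->] := ltgtP a 0; last by rewrite sin0.
- by rewrite -normrN -sinN (ltr0_norm a0) pos// oppr_gt0.
- by rewrite (gtr0_norm a0) pos.
Qed.

Lemma onem_cos a : 1 - cos a = sin (a / 2) ^+ 2 *+ 2.
Proof.
rewrite [in LHS](splitr a) cosD -!expr2 cos2sin2 mulr2n; ring.
Qed.

Lemma rnorm_cisB1 a : rnorm (cis a - 1) <= `|a|.
Proof.
rewrite rnorm_complexE /= -sqrtr_sqr ler_wsqrtr//.
have -> : (cos a - 1) ^+ 2 + (sin a - 0) ^+ 2 = 2 * (1 - cos a).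
  by rewrite subr0 sin2cos2; ring.
rewrite onem_cos; have := abs_sin_le (a / 2).
rewrite -ler_sqr ?nnegrE// !real_normK ?num_real// => h; lra.
Qed.

Definition croot (M : nat) : R[i] := cis (pi *+ 2 / M%:R).

Lemma crootX M k : croot M ^+ k = cis (pi *+ 2 * (k%:R / M%:R)).
Proof. by rewrite cisX; congr cis; rewrite mulrAC mulrA. Qed.

Lemma croot_order M : (0 < M)%N -> croot M ^+ M = 1.
Proof.
move=> M0; rewrite crootX divff ?pnatr_eq0 -?lt0n// mulr1.
by apply/eqP; rewrite eq_complex /= cos2pi sin2pi !eqxx.
Qed.

Lemma rnorm_crootX M k : rnorm (croot M ^+ k) = 1.
Proof. by rewrite crootX rnorm_cis. Qed.

Lemma crootX_mod M k : (0 < M)%N -> croot M ^+ (k %% M) = croot M ^+ k.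
Proof.
by move=> M0; rewrite {2}(divn_eq k M) exprD mulnC exprM croot_order// expr1n mul1r.
Qed.

Lemma mul_conjc (z : R[i]) : z * conjc z = (rnorm z ^+ 2)%:C.
Proof.
rewrite rnorm_complexE sqr_sqrtr ?addr_ge0 ?sqr_ge0//.
case: z => u v; apply/eqP; rewrite eq_complex /=.
by apply/andP; split; apply/eqP; ring.
Qed.

(** Exponents are natural numbers, so [M - m] stands for -m; the inverse of a number of modulus 1 is
    its conjugate. *)
Lemma croot_conjc M m k : (0 < M)%N -> (m <= M)%N ->
  (croot M ^+ (M - m)) ^+ k = conjc (croot M ^+ (m * k)).
Proof.
move=> M0 mM.
have n0 : croot M ^+ (m * k) != 0.
  apply/eqP => z0; have := rnorm_crootX M (m * k); rewrite z0 rnorm0 => /eqP.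
  by rewrite eq_sym oner_eq0.
apply: (mulfI n0); rewrite mul_conjc rnorm_crootX expr1n.
by rewrite -exprM -exprD -mulnDl subnKC// exprM croot_order// expr1n.
Qed.

(** An angle t with cos t = 1 has sin (t / 2) = 0 by [onem_cos], but once k is reduced modulo M, t /
    2 lies strictly between 0 and pi. *)
Lemma crootX_neq1 M k : (0 < M)%N -> ~~ (M %| k)%N -> croot M ^+ k != 1.
Proof.
move=> M0; rewrite -crootX_mod// /dvdn -lt0n => k0.
have kM : (k %% M < M)%N by rewrite ltn_mod.
move: (k %% M)%N k0 kM => n n0 nM; rewrite crootX.
set t := pi *+ 2 * _; apply/negP => /eqP /(congr1 (@complex.Re R)) /= c1.
have : sin (t / 2) = 0.
  have := onem_cos t; rewrite c1 subrr => /esym/eqP.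
  by rewrite mulrn_eq0 /= sqrf_eq0 => /eqP.
apply/eqP; rewrite gt_eqF// sin_gt0_pi//.
have -> : t / 2 = pi * (n%:R / M%:R) by rewrite /t mulr2n; field; rewrite pnatr_eq0 -lt0n.
rewrite mulr_gt0 ?pi_gt0 ?divr_gt0 ?ltr0n//=.
by rewrite gtr_pMr ?pi_gt0// ltr_pdivrMr ?ltr0n// mul1r ltr_nat.
Qed.

(** Orthogonality of the characters of Z/M. *)
Lemma sum_crootX M n : (0 < M)%N ->
  \sum_(l < M) croot M ^+ (l * n) = if (M %| n)%N then M%:R else 0.
Proof.
move=> M0; case: ifPn => [/dvdnP[q ->]|Mn].
  rewrite (eq_bigr (fun=> 1)) ?sumr_const ?card_ord// => l _.
  by rewrite mulnA mulnC exprM croot_order// expr1n.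
have z1 := crootX_neq1 M0 Mn; apply: (mulfI (x := croot M ^+ n - 1)).
  by rewrite subr_eq0.
under eq_bigr do rewrite mulnC exprM.
by rewrite -subrX1 -exprM mulnC exprM croot_order// expr1n subrr mulr0.
Qed.

(** The 8 is an upper bound for 2 pi. *)
Lemma rnorm_crootB1 M k : rnorm (croot M ^+ k - 1) <= 8 * (k%:R / M%:R).
Proof.
rewrite crootX; apply: le_trans (rnorm_cisB1 _) _.
have kM : 0 <= k%:R / M%:R :> R by rewrite divr_ge0.
rewrite ger0_norm; last by rewrite mulr_ge0// mulrn_wge0// pi_ge0.
apply: ler_wpM2r => //; have := @pihalf_lt2 R; lra.
Qed.

Lemma croot_divisor q s : (0 < s)%N -> croot (q * s) ^+ s = croot q.
Proof.
move=> s0; rewrite crootX /croot; congr cis.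
by congr (_ * _); rewrite natrM invfM mulrCA mulfV ?mulr1// pnatr_eq0 -lt0n.
Qed.

Lemma Re_croot_le0 q k : (0 < q)%N -> (q <= 4 * k)%N -> (4 * k <= 3 * q)%N ->
  Re (croot q ^+ k) <= 0.
Proof.
move=> q0 qk kq; rewrite crootX /=.
set t := pi *+ 2 * _; have -> : t = (t - pi / 2) + pi / 2 by rewrite subrK.
rewrite cosDpihalf oppr_le0 sin_ge0_pi//.
have q0' : 0 < q%:R :> R by rewrite ltr0n.
have k1 : 1 / 4 <= k%:R / q%:R :> R.
  rewrite ler_pdivlMr//; move: qk; rewrite -(ler_nat R) natrM; lra.
have k2 : k%:R / q%:R <= 3 / 4 :> R.
  rewrite ler_pdivrMr//; move: kq; rewrite -(ler_nat R) !natrM; lra.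
have p0 := @pi_gt0 R; rewrite /t; set r := k%:R / q%:R in k1 k2 *.
by apply/andP; split; nra.
Qed.

End roots_of_unity.

(** * Partial sums of the powers of an operator *)

Section power_partial_sums.
Context {R : realType} {V : normedModType R[i]} (T : {linear V -> V}).
Implicit Types (x y : V) (z a b : R[i]).

(** Truncated Neumann series of the inverse of I - zT. *)
Definition psum z K x : V := \sum_(k < K) z ^+ k *: iter k T x.

Lemma iter_linear n : linear (iter n T).
Proof.
by elim: n => [|n IH] a x y //=; rewrite IH linearP.
Qed.

HB.instance Definition _ n :=
  GRing.isLinear.Build R[i] V V *:%R (iter n T) (iter_linear n).

Lemma psum_linear z K : linear (psum z K).
Proof.
move=> a x y; rewrite /psum scaler_sumr -big_split /=; apply: eq_bigr => k _.
by rewrite linearP scalerDr !scalerA mulrC.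
Qed.

HB.instance Definition _ z K :=
  GRing.isLinear.Build R[i] V V *:%R (psum z K) (psum_linear z K).

Lemma psum_telescope z K x :
  psum z K x - z *: T (psum z K x) = x - z ^+ K *: iter K T x.
Proof.
rewrite /psum (linear_sum T) scaler_sumr -sumrB.
under eq_bigr do rewrite (linearZ_LR T) scalerA -exprS -iterS.
elim: K => [|K IH]; first by rewrite big_ord0 expr0 scale1r subrr.
by rewrite big_ord_recr /= IH addrA subrK.
Qed.

Lemma psum0 K x : (0 < K)%N -> psum 0 K x = x.
Proof.
case: K => // K _; rewrite /psum big_ord_recl expr0 scale1r big1 ?addr0// => k _.
by rewrite expr0n scale0r.
Qed.

Lemma psum_psum a b K x :
  psum a K (psum b K x) =
  \sum_(i < K) \sum_(k < K) (a ^+ i * b ^+ k) *: iter (i + k) T x.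
Proof.
rewrite {1}/psum; apply: eq_bigr => i _; rewrite linear_sum scaler_sumr.
by apply: eq_bigr => k _; rewrite linearZ /= scalerA iterD.
Qed.

(** A discrete Fourier coefficient, with [M - N] in the role of -N. The exponents i + k stay below
    2K <= M, so N is the only one of them congruent to N modulo M: there is no aliasing, and the
    Cauchy product coefficient survives. *)
Lemma psum_extraction a b M N K x : (N < K)%N -> (2 * K <= M)%N ->
  \sum_(l < M) croot M ^+ (l * (M - N)) *:
      psum (a * croot M ^+ l) K (psum (b * croot M ^+ l) K x) =
  (M%:R * \sum_(k < N.+1) a ^+ (N - k) * b ^+ k) *: iter N T x.
Proof.
move=> NK KM; set w := croot M.
have M0 : (0 < M)%N by lia.
have ort (i k : 'I_K) : \sum_(l < M) w ^+ (l * (M - N + (i + k))) =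
    if (i + k == N)%N then M%:R else 0.
  rewrite sum_crootX//; congr (if _ then _ else _).
  have iK := ltn_ord i; have kK := ltn_ord k.
  apply/idP/eqP => [/dvdnP[q qM]|e]; last by rewrite e subnK//; lia.
  have q1 : q = 1%N.
    have : (0 < q * M)%N by lia.
    have : (q * M < 2 * M)%N by lia.
    by rewrite ltn_pmul2r//; case: q {qM} => [|[|]].
  by move: qM; rewrite q1 mul1n; lia.
under eq_bigr => l _.
  rewrite psum_psum scaler_sumr.
  under eq_bigr => i _.
    rewrite scaler_sumr.
    under eq_bigr => k _.
      rewrite scalerA (_ : _ * _ =
        a ^+ i * b ^+ k * w ^+ (l * (M - N + (i + k)))); last first.
        by rewrite !exprMn -!exprM !mulnDr !exprD; ring.
      over.
    over.
  over.
rewrite exchange_big /=.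
under eq_bigr => i _.
  rewrite exchange_big /=.
  under eq_bigr => k _.
    rewrite -scaler_suml -mulr_sumr ort.
    over.
  over.
rewrite exchange_big /= mulr_sumr scaler_suml.
rewrite (big_ord_widen K (fun k => (M%:R * (a ^+ (N - k) * b ^+ k)) *: iter N T x))//.
rewrite [RHS]big_mkcond; apply: eq_bigr => k _ /=.
have kK := ltn_ord k.
case: ltnP => kN; last first.
  rewrite big1// => i _; case: eqP => [?|_]; last by rewrite mulr0 scale0r.
  by exfalso; lia.
have NkK : (N - k < K)%N by lia.
rewrite (bigD1 (Ordinal NkK))//= big1 ?addr0.
  by rewrite subnK// eqxx; congr (_ *: _); rewrite mulrC.
move=> i iN; case: eqP => [e|_]; last by rewrite mulr0 scale0r.
by move: iN; rewrite -val_eqE /= -e addnK eqxx.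
Qed.

Context (t C : R).
Hypothesis t0 : 0 <= t.
Hypothesis Tt : forall x, rnorm (T x) <= t * rnorm x.
Hypothesis C0 : 0 <= C.
Hypothesis TC : forall z x, rnorm z < 1 ->
  (1 - rnorm z) * rnorm x <= C * rnorm (x - z *: T x).

(** [TC] is applied to the partial sum itself, whose image under I - zT is x minus a remainder no
    larger than x. *)
Lemma psum_bound z K x : rnorm z < 1 ->
    rnorm z ^+ K * rnorm (iter K T x) <= rnorm x ->
  (1 - rnorm z) * rnorm (psum z K x) <= 2 * C * rnorm x.
Proof.
move=> z1 zK; apply: le_trans (TC _ z1) _; rewrite psum_telescope.
rewrite [2 * C]mulrC -mulrA; apply: ler_wpM2l => //.
apply: le_trans (rnormB _ _) _.
by rewrite rnormZ rnormX mulr_natl mulr2n lerD2l.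
Qed.

(** A resolvent identity: since z' ^+ K = z ^+ K both sums leave the same remainder, so I - zT maps
    their difference to (z - z') T P'. Using the lower bound twice produces the square of 1 -
    |z|. *)
Lemma psum_lipschitz z z' K x : rnorm z < 1 -> rnorm z' = rnorm z ->
    z' ^+ K = z ^+ K -> rnorm z ^+ K * rnorm (iter K T x) <= rnorm x ->
  (1 - rnorm z) ^+ 2 * rnorm (psum z K x - psum z' K x) <=
  2 * C ^+ 2 * t * rnorm (z - z') * rnorm x.
Proof.
move=> z1 z'z z'K zK; set P := psum z K x; set P' := psum z' K x.
have e : (P - P') - z *: T (P - P') = (z - z') *: T P'.
  have := psum_telescope z' K x; rewrite z'K -(psum_telescope z K x) -/P -/P'.
  rewrite linearB scalerBr scalerBl /= => h.
  by rewrite opprB [_ *: _ - _]addrC addrACA -h addrACA subrr add0r addrC.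
have b1 := TC (P - P') z1; rewrite e rnormZ in b1.
have b2 : (1 - rnorm z) * rnorm P' <= 2 * C * rnorm x.
  by rewrite -z'z; apply: psum_bound; rewrite z'z.
have b3 := Tt P'.
have r0 : 0 <= 1 - rnorm z by rewrite subr_ge0 ltW.
rewrite expr2 -mulrA.
apply: le_trans (ler_wpM2l r0 b1) _.
have d0 := rnorm_ge0 (z - z').
apply: (@le_trans _ _ (C * rnorm (z - z') * t * ((1 - rnorm z) * rnorm P'))).
  rewrite [leRHS](_ : _ = (1 - rnorm z) * (C * (rnorm (z - z') * (t * rnorm P')))).
    by do 3 apply: ler_wpM2l => //.
  ring.
rewrite [leRHS](_ : _ = C * rnorm (z - z') * t * (2 * C * rnorm x)); last by ring.
by apply: ler_wpM2l => //; rewrite !mulr_ge0.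
Qed.

End power_partial_sums.

(** * Spectral radius *)

Lemma exprn_small (R : realType) (c e : R) : 0 <= c < 1 -> 0 < e ->
  exists q0, forall q, (q0 <= q)%N -> c ^+ q <= e.
Proof.
move=> /andP[c0 c1] e0.
have c1' : `|c| < 1 by rewrite ger0_norm.
have /cvgrPdist_le /(_ e e0) [q0 _ h] := cvg_expr c1'.
exists q0 => q /h /=; rewrite sub0r normrN ger0_norm// exprn_ge0//.
Qed.

Lemma bernoulli_onem (R : realType) (a : R) n : 0 <= a <= 1 ->
  1 - n%:R * a <= (1 - a) ^+ n.
Proof.
move=> /andP[a0 a1]; elim: n => [|n IH]; first by rewrite mul0r subr0 expr0.
rewrite exprS; have h : 0 <= 1 - a by rewrite subr_ge0.
apply: le_trans (ler_wpM2l h IH).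
have : 0 <= n%:R * a * a by rewrite !mulr_ge0.
rewrite -natr1; lra.
Qed.

Section spectral_radius.
Context {R : realType} {V : normedModType R[i]} (T : {linear V -> V}).
Implicit Types (x y : V) (z a b : R[i]).
Context (t C : R).
Hypothesis t0 : 0 <= t.
Hypothesis Tt : forall x, rnorm (T x) <= t * rnorm x.
Hypothesis C0 : 0 <= C.
Hypothesis TC : forall z x, rnorm z < 1 ->
  (1 - rnorm z) * rnorm x <= C * rnorm (x - z *: T x).

(** Some positive power of rT is a strict contraction: r times the limit of |T^n|^(1/n) is below
    1. *)
Let contracts (r : R) := exists n, (0 < n)%N /\ exists c, 0 <= c < 1 /\
  forall x, r ^+ n * rnorm (iter n T x) <= c * rnorm x.

Lemma rnorm_iter n x : rnorm (iter n T x) <= t ^+ n * rnorm x.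
Proof.
elim: n => [|n IH]; first by rewrite expr0 mul1r.
by rewrite iterS exprS -mulrA (le_trans (Tt _))// ler_wpM2l.
Qed.

(** Divide K by n: the quotient q contributes c^q, which for large q beats the bound B on the fewer
    than n remaining factors. *)
Let contracts_eventually r : 0 <= r -> contracts r ->
  exists K0, forall K, (K0 <= K)%N -> forall x,
    r ^+ K * rnorm (iter K T x) <= rnorm x.
Proof.
move=> r0 [n [n0 [c [c01 cT]]]].
have c0 : 0 <= c by case/andP: c01.
pose B := Num.max 1 (r * t) ^+ n.
have m1 : 1 <= Num.max 1 (r * t) by rewrite le_max lexx.
have B1 : 1 <= B by rewrite exprn_ege1.
have B0 : 0 < B by apply: lt_le_trans B1.
have Bi0 : 0 < B^-1 by rewrite invr_gt0.
have [q0 hq] := exprn_small c01 Bi0.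
exists (q0 * n)%N => K nK x.
have powq q y : r ^+ (q * n) * rnorm (iter (q * n) T y) <= c ^+ q * rnorm y.
  elim: q => [|q IH]; first by rewrite mul0n !expr0 !mul1r.
  rewrite mulSn exprD iterD exprS.
  rewrite mulrAC; apply: le_trans (ler_wpM2r _ (cT _)) _.
    by rewrite exprn_ge0.
  by rewrite -!mulrA [_ * r ^+ _]mulrC ler_wpM2l.
rewrite (divn_eq K n) exprD iterD mulrAC.
have qq : (q0 <= K %/ n)%N by rewrite leq_divRL.
apply: le_trans (ler_wpM2r _ (powq _ _)) _; first by rewrite exprn_ge0.
have st : r ^+ (K %% n) * rnorm (iter (K %% n) T x) <= B * rnorm x.
  apply: (@le_trans _ _ ((r * t) ^+ (K %% n) * rnorm x)).
    by rewrite exprMn -mulrA ler_wpM2l ?exprn_ge0// rnorm_iter.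
  apply: ler_wpM2r; first exact: rnorm_ge0.
  apply: (@le_trans _ _ (Num.max 1 (r * t) ^+ (K %% n))).
    by rewrite lerXn2r ?nnegrE ?mulr_ge0 ?(le_trans ler01 m1)// le_max lexx orbT.
  by rewrite /B ler_weXn2l// ltnW// ltn_mod.
rewrite -mulrA [_ * r ^+ _]mulrC.
apply: le_trans (ler_wpM2l _ st) _; first by rewrite exprn_ge0.
rewrite mulrA ler_piMl ?rnorm_ge0//.
by rewrite -ler_pdivlMr// div1r hq.
Qed.

(** The partial sum at z is compared with the one at z rotated by the angle pi / n. The rotation
    changes the sign of the n-th coefficient, so the difference doubles it, while the two points are
    O(1/n) apart and [psum_lipschitz] yields a factor 1/n. The resulting bound depends on rho but
    not on r, which [power_decay] relies on. *)
Let contracts_step r rho n : 0 <= r <= rho -> rho < 1 -> contracts r -> (0 < n)%N ->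
  forall x, (n%:R * (1 - rho) ^+ 2) * (r ^+ n * rnorm (iter n T x)) <=
    4 * C ^+ 2 * t * rnorm x.
Proof.
move=> /andP[r0 rrho] rho1 rT n0 x.
have r1 : r < 1 by apply: le_lt_trans rho1.
have [K0 hK] := contracts_eventually r0 rT.
(* M is 2n times h, so w ^+ h has order 2n; h is even, so (w ^+ h) ^+ K = (-1) ^ h = 1 and the two
   remainders agree. *)
pose K := (n * (2 * K0.+1))%N; pose M := (2 * n * (2 * K0.+1))%N.
pose h := (2 * K0.+1)%N; pose w := croot M : R[i].
have nK : (n < K)%N by rewrite /K; nia.
have KM : (2 * K <= M)%N by rewrite /K /M; nia.
have M0 : (0 < M)%N by rewrite /M; nia.
have K0K : (K0 <= K)%N by rewrite /K; nia.
have whn : w ^+ (h * n) = -1.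
  rewrite exprM /w /M /h croot_divisor// -[X in croot X]/(2 * n)%N croot_divisor//.
  rewrite /croot (_ : pi *+ 2 / 2 = pi); last by rewrite mulr2n; lra.
  by apply/eqP; rewrite eq_complex /= cospi sinpi oppr0 !eqxx.
have whK : w ^+ (h * K) = 1.
  have -> : (h * K = M * K0.+1)%N by rewrite /h /K /M; lia.
  by rewrite exprM croot_order// expr1n.
(* With b = 0 the inner partial sum is x, and the extraction reads off one coefficient. *)
have ext a : \sum_(l < M) w ^+ (l * (M - n)) *: psum T (a * w ^+ l) K x =
    (M%:R * a ^+ n) *: iter n T x.
  have := psum_extraction T a 0 x nK KM.
  under eq_bigr do rewrite mul0r psum0 ?(leq_ltn_trans _ nK)//.
  move=> ->; congr (_ * _ *: _); rewrite big_ord_recl big1 ?addr0.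
    by rewrite subn0 expr0 mulr1.
  by move=> i _; rewrite expr0n mulr0.
pose D l := psum T (r%:C * w ^+ l) K x - psum T (r%:C * w ^+ h * w ^+ l) K x.
have nr l : rnorm (r%:C * w ^+ l) = r.
  by rewrite rnormM rnorm_real ger0_norm// rnorm_crootX mulr1.
have eD : \sum_(l < M) w ^+ (l * (M - n)) *: D l = (2 * M%:R * r%:C ^+ n) *: iter n T x.
  under eq_bigr do rewrite scalerBr.
  rewrite sumrB !ext exprMn -exprM whn -scalerBl; congr (_ *: _); ring.
have nD l : (1 - rho) ^+ 2 * rnorm (D l) <= (2 * C ^+ 2 * t * (8 * (h%:R / M%:R))) * rnorm x.
  apply: (@le_trans _ _ ((1 - r) ^+ 2 * rnorm (D l))).
    apply: ler_wpM2r; first exact: rnorm_ge0.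
    by rewrite lerXn2r ?nnegrE ?subr_ge0 ?(ltW rho1) ?(ltW r1)// lerB.
  have := psum_lipschitz t0 Tt C0 TC (z := r%:C * w ^+ l)
    (z' := r%:C * w ^+ h * w ^+ l) (K := K) (x := x).
  rewrite nr => /(_ r1) {}h'; apply: le_trans (h' _ _ _) _.
  - by rewrite -mulrA -exprD nr.
  - by rewrite -mulrA mulrCA exprMn -exprM whK mul1r.
  - exact: hK.
  apply: ler_wpM2r; first exact: rnorm_ge0.
  apply: ler_wpM2l; first by rewrite !mulr_ge0// sqr_ge0.
  have -> : r%:C * w ^+ l - r%:C * w ^+ h * w ^+ l = - (r%:C * w ^+ l * (w ^+ h - 1)).
    ring.
  rewrite rnormN rnormM nr; apply: le_trans (rnorm_crootB1 _ _).
  by rewrite ler_piMl ?rnorm_ge0// ltW.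
have M0' : 0 < M%:R :> R by rewrite ltr0n.
have n0' : 0 < n%:R :> R by rewrite ltr0n.
have := ler_rnorm_sum (index_enum 'I_M) xpredT (fun l : 'I_M => w ^+ (l * (M - n)) *: D l).
rewrite eD rnormZ !rnormM !rnorm_nat rnormX rnorm_real (ger0_norm r0) => b.
have s0 : 0 <= (1 - rho) ^+ 2 by rewrite sqr_ge0.
have {b} := ler_wpM2l s0 b; rewrite mulr_sumr => b.
have b2 : \sum_(i < M) (1 - rho) ^+ 2 * rnorm (w ^+ (i * (M - n)) *: D i) <=
   \sum_(i < M) (2 * C ^+ 2 * t * (8 * (h%:R / M%:R))) * rnorm x.
  by apply: ler_sum => i _; rewrite rnormZ rnorm_crootX mul1r nD.
have {b b2} := le_trans b b2; rewrite sumr_const card_ord -[leRHS]mulr_natr => b.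
rewrite -(ler_pM2l (_ : 0 < 2 * M%:R / n%:R)); last by rewrite divr_gt0// mulr_gt0.
rewrite [leLHS](_ : _ = (1 - rho) ^+ 2 * (2 * M%:R * r ^+ n * rnorm (iter n T x))); last first.
  by field; rewrite gt_eqF.
apply: (le_trans b).
have -> : h%:R / M%:R = 1 / (2 * n%:R) :> R.
  by rewrite /M /h !natrM; field; rewrite gt_eqF//= -natrM pnatr_eq0.
rewrite le_eqVlt; apply/orP; left; apply/eqP; field; rewrite gt_eqF//.
Qed.

(** Continuation in the radius. For some n independent of r, every contracting r <= rho satisfies
    r^n |T^n x| <= |x| / 2. This slack allows r to grow by the ratio 1/d with d^n >= 3/4: the bound
    becomes 2/3, again a contraction. Starting from r0, where T itself is small enough, finitely
    many increases reach rho. *)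
Lemma power_decay rho : 0 <= rho < 1 -> exists K0, forall K, (K0 <= K)%N ->
  forall x, rho ^+ K * rnorm (iter K T x) <= rnorm x.
Proof.
move=> /andP[rho0 rho1]; apply: contracts_eventually => //.
have d0 : 0 < 1 - rho by rewrite subr_gt0.
pose A := 4 * C ^+ 2 * t / (1 - rho) ^+ 2.
have A0 : 0 <= A by rewrite !mulr_ge0 ?invr_ge0 ?sqr_ge0.
pose n := (Num.truncn (2 * A)).+1.
have nA : A / n%:R <= 1 / 2.
  rewrite ler_pdivrMr ?ltr0n// mulrC mulr_natl -mulr_natr.
  have := truncnS_gt (2 * A); rewrite -/n; lra.
have step r : 0 <= r <= rho -> contracts r -> forall x,
    r ^+ n * rnorm (iter n T x) <= 1 / 2 * rnorm x.
  move=> r0 cr x; have := contracts_step r0 rho1 cr (ltn0Sn _ : (0 < n)%N) x.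
  move=> b; apply: le_trans (ler_wpM2r (rnorm_ge0 x) nA).
  rewrite -(ler_pM2l (_ : 0 < n%:R * (1 - rho) ^+ 2)); last by rewrite mulr_gt0 ?ltr0n ?exprn_gt0.
  apply: (le_trans b); rewrite le_eqVlt; apply/orP; left; apply/eqP; rewrite /A.
  by field; rewrite !gt_eqF ?ltr0n.
have mono r r' : 0 <= r' <= r -> contracts r -> contracts r'.
  move=> /andP[r'0 rr] [m [m0 [c [c01 cT]]]]; exists m; split=> //; exists c; split=> // x.
  apply: le_trans (cT x); apply: ler_wpM2r; first exact: rnorm_ge0.
  by rewrite lerXn2r ?nnegrE// (le_trans r'0).
pose r0 := (2 * (t + 1))^-1.
have t1 : 0 < t + 1 by rewrite ltr_wpDl.
have cr0 : contracts r0.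
  exists 1%N; split=> //; exists (1 / 2); split; first by apply/andP; split; lra.
  move=> x; rewrite expr1 /= /r0 invfM -mulrA div1r ler_pM2l ?invr_gt0//.
  rewrite ler_pdivrMl//; apply: le_trans (Tt x) _.
  by apply: ler_wpM2r; [exact: rnorm_ge0|rewrite lerDl].
have r00 : 0 < r0 by rewrite invr_gt0 mulr_gt0.
pose d := 1 - (4 * n%:R)^-1 : R.
have n1 : 1 <= n%:R :> R by rewrite (ler_nat _ 1).
have n4 : 0 < 4 * n%:R :> R by lra.
have i4 : (4 * n%:R)^-1 <= 1 / 4 :> R.
  rewrite invfM div1r ler_piMr// ?invr_ge0// invf_le1//; lra.
have i40 : 0 < (4 * n%:R)^-1 :> R by rewrite invr_gt0.
have dn : 3 / 4 <= d ^+ n.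
  have := @bernoulli_onem R (4 * n%:R)^-1 n; rewrite -/d.
  rewrite (_ : n%:R * _ = 1 / 4); last by field; rewrite gt_eqF//; lra.
  move=> h; apply: le_trans (h _); first lra.
  by apply/andP; split; lra.
have d01 : 0 <= d < 1 by rewrite /d; apply/andP; split; lra.
case/andP: (d01) => d0' d1'.
have ind k r : 0 <= r <= rho -> d ^+ k * r <= r0 -> contracts r.
  elim: k r => [|k IH] r /andP[rp rr] kr.
    by apply: mono cr0; rewrite rp -[r]mul1r.
  have dr : 0 <= d * r <= rho.
    by rewrite mulr_ge0//= (le_trans _ rr)// ler_piMl// ltW.
  have cdr : contracts (d * r) by apply: IH => //; rewrite mulrA -exprSr.
  exists n; split=> //; exists (2 / 3); split; first by apply/andP; split; lra.
  move=> x; have := step _ dr cdr x; rewrite exprMn -[leLHS]mulrA.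
  set Y := r ^+ n * _ => b.
  have Y0 : 0 <= Y by rewrite mulr_ge0 ?rnorm_ge0// exprn_ge0.
  have := le_trans (ler_wpM2r Y0 dn) b; clearbody Y; lra.
have [q hq] := exprn_small d01 r00.
apply: (ind q); first by rewrite rho0 /=.
apply: le_trans (hq q (leqnn _)).
by rewrite ler_piMr ?exprn_ge0// ltW.
Qed.

End spectral_radius.

(** * Lacunary sums in 2-uniformly smooth spaces *)

(** Lagrange's identity: twice the gap is a double sum of squares. *)
Lemma sum_mul_sqr_le (R : realDomainType) (I : finType) (a b : I -> R) :
  (\sum_i a i * b i) ^+ 2 <= (\sum_i a i ^+ 2) * (\sum_i b i ^+ 2).
Proof.
rewrite -subr_ge0 -(pmulrn_lge0 _ (ltn0Sn 1)).
suff -> : ((\sum_i a i ^+ 2) * (\sum_i b i ^+ 2) - (\sum_i a i * b i) ^+ 2) *+ 2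
    = \sum_i \sum_j (a i * b j - a j * b i) ^+ 2.
  by apply: sumr_ge0 => i _; apply: sumr_ge0 => j _; exact: sqr_ge0.
rewrite expr2 !big_distrlr /= mulrnBl mulr2n.
rewrite [X in _ + X - _]exchange_big /= -big_split /= -sumrMnl -sumrB.
apply: eq_bigr => i _; rewrite -big_split /= -sumrMnl -sumrB.
by apply: eq_bigr => j _; ring.
Qed.

Lemma cauchy_schwarz_sum (R : rcfType) (I : finType) (a b : I -> R) :
  \sum_i a i * b i <= Num.sqrt (\sum_i a i ^+ 2) * Num.sqrt (\sum_i b i ^+ 2).
Proof.
rewrite -sqrtrM ?sumr_ge0//; last by move=> i _; exact: sqr_ge0.
apply: le_trans (ler_norm _) _; rewrite -sqrtr_sqr ler_wsqrtr//.
exact: sum_mul_sqr_le.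
Qed.

Lemma sum_periodic_shift (V : zmodType) M (f : nat -> V) s :
  (forall l, f (l + M)%N = f l) -> \sum_(l < M) f (l + s)%N = \sum_(l < M) f l.
Proof.
move=> fM; elim: s => [|s IH].
  by apply: eq_bigr => l _; rewrite addn0.
rewrite -{}IH; under eq_bigr do rewrite addnS -addSn.
case: M fM => [|M] fM; first by rewrite !big_ord0.
by rewrite big_ord_recr [RHS]big_ord_recl /= add0n [(M.+1 + s)%N]addnC fM addrC.
Qed.

Lemma sum_ord_addn (V : nmodType) m n (f : nat -> V) :
  \sum_(i < m + n) f i = \sum_(i < m) f i + \sum_(i < n) f (m + i)%N.
Proof. by rewrite big_split_ord. Qed.

(** * L^2 norms over one period *)

Section l2_norm.
Context {R : realType} {Y : normedModType R[i]} (M : nat).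
Implicit Types f g : nat -> Y.

Definition l2norm f : R := Num.sqrt (\sum_(l < M) rnorm (f l) ^+ 2).

Lemma l2norm_ge0 f : 0 <= l2norm f. Proof. exact: sqrtr_ge0. Qed.

Lemma sqr_l2norm f : l2norm f ^+ 2 = \sum_(l < M) rnorm (f l) ^+ 2.
Proof. by rewrite sqr_sqrtr// sumr_ge0// => l _; exact: sqr_ge0. Qed.

Lemma eq_l2norm f g : (forall l, f l = g l) -> l2norm f = l2norm g.
Proof. by move=> fg; congr Num.sqrt; apply: eq_bigr => l _; rewrite fg. Qed.

Lemma sum_rnormM_le f g :
  \sum_(l < M) rnorm (f l) * rnorm (g l) <= l2norm f * l2norm g.
Proof. exact: cauchy_schwarz_sum. Qed.

Lemma l2normD f g : l2norm (fun l => f l + g l) <= l2norm f + l2norm g.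
Proof.
rewrite -ler_sqr ?nnegrE ?addr_ge0 ?l2norm_ge0// sqrrD !sqr_l2norm.
apply: (@le_trans _ _ (\sum_(l < M) (rnorm (f l) + rnorm (g l)) ^+ 2)).
  by apply: ler_sum => l _; rewrite ler_sqr ?nnegrE ?addr_ge0 ?rnorm_ge0// rnormD.
under eq_bigr do rewrite sqrrD; rewrite !big_split /= lerD2r lerD2l mulr2n.
by rewrite lerD// sum_rnormM_le.
Qed.

Lemma l2normZ (a : R[i]) f : l2norm (fun l => a *: f l) = rnorm a * l2norm f.
Proof.
rewrite /l2norm; under eq_bigr do rewrite rnormZ exprMn.
by rewrite -mulr_sumr sqrtrM ?sqr_ge0// sqrtr_sqr ger0_norm ?rnorm_ge0.
Qed.

Lemma l2norm0 : l2norm (fun=> 0) = 0.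
Proof. by rewrite /l2norm big1 ?sqrtr0// => l _; rewrite rnorm0 expr0n. Qed.

Lemma l2norm_sum (I : Type) (r : seq I) (P : pred I) (F : I -> nat -> Y) :
  l2norm (fun l => \sum_(i <- r | P i) F i l) <= \sum_(i <- r | P i) l2norm (F i).
Proof.
elim: r => [|i r IH].
  rewrite big_nil (_ : l2norm _ = 0) //.
  by rewrite -[RHS]l2norm0; apply: eq_l2norm => l; rewrite big_nil.
rewrite big_cons; case: (boolP (P i)) => Pi.
  apply: le_trans (lerD (lexx _) IH); apply: le_trans (l2normD _ _).
  by rewrite le_eqVlt; apply/orP; left; apply/eqP/eq_l2norm => l; rewrite big_cons Pi.
apply: le_trans IH.
by rewrite le_eqVlt; apply/orP; left; apply/eqP/eq_l2norm => l; rewrite big_cons (negbTE Pi).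
Qed.

Lemma l2normN f : l2norm (fun l => - f l) = l2norm f.
Proof. by congr Num.sqrt; apply: eq_bigr => l _; rewrite rnormN. Qed.

Lemma l2normB f g : l2norm (fun l => f l - g l) <= l2norm f + l2norm g.
Proof. by rewrite -(l2normN g); exact: l2normD. Qed.

Lemma l2norm_shift f s : (forall l, f (l + M)%N = f l) ->
  l2norm (fun l => f (l + s)%N) = l2norm f.
Proof.
move=> fM; congr Num.sqrt.
by apply: (@sum_periodic_shift _ M (fun l => rnorm (f l) ^+ 2)) => l; rewrite fM.
Qed.

Lemma l2norm_le f (B : R) : 0 <= B -> (forall l, rnorm (f l) <= B) ->
  l2norm f <= Num.sqrt M%:R * B.
Proof.
move=> B0 fB; rewrite -(ger0_norm B0) -(sqrtr_sqr B) -sqrtrM// ler_wsqrtr//.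
rewrite mulr_natl -[M in leRHS]card_ord -sumr_const.
by apply: ler_sum => l _; rewrite ler_sqr ?nnegrE ?rnorm_ge0.
Qed.

Lemma sum_rnorm_le f : \sum_(l < M) rnorm (f l) <= Num.sqrt M%:R * l2norm f.
Proof.
apply: le_trans (le_trans (cauchy_schwarz_sum (fun=> 1) (fun l : 'I_M => rnorm (f l))) _).
  by rewrite le_eqVlt; apply/orP; left; apply/eqP/eq_bigr => l _; rewrite mul1r.
by rewrite expr1n sumr_const card_ord.
Qed.

End l2_norm.

Section smooth_space.
Context {R : realType} {Y : normedModType R[i]}.

(* [J u] plays the role of the real part of the normalized duality map at [u];
   its Lipschitz continuity expresses that [Y] is 2-uniformly smooth. *)
Definition smooth_duality (J : Y -> Y -> R) (c : R) : Prop :=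
  [/\ forall u, {morph J u : v w / v + w},
      forall u, J u u = rnorm u ^+ 2,
      forall u v, J u v <= rnorm u * rnorm v &
      forall u u' v, `|J u v - J u' v| <= c * rnorm (u - u') * rnorm v].

Context (J : Y -> Y -> R) (c : R).
Hypothesis c0 : 0 <= c.
Hypothesis JP : smooth_duality J c.
Context (M L : nat) (h : nat -> nat -> Y) (s : nat -> nat) (G : R).
Hypothesis hM : forall j l, h j (l + M)%N = h j l.
Hypothesis hG : forall j, (j < L)%N -> l2norm M (h j) <= G.
Hypothesis hs : forall k j, (k <= j < L)%N ->
  l2norm M (fun l => h k l - h k (l + s j)%N) <= G * (2 ^+ k / 2 ^+ j).

Let g j l := h j l - h j (l + s j)%N.
Let S n l := \sum_(j < n) g j l.

Let gM j l : g j (l + M)%N = g j l.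
Proof. by rewrite /g hM addnAC hM. Qed.

Let SM n l : S n (l + M)%N = S n l.
Proof. by apply: eq_bigr => j _; rewrite gM. Qed.

(** Translation by s n changes g k by d (l + s k) - d l, where d = h k - h k (l + s n) has norm at
    most G 2^(k - n). The two terms and the geometric sum over k each cost a factor 2. *)
Let S_shift n : (n < L)%N ->
  l2norm M (fun l => S n.+1 (l + s n)%N - S n.+1 l) <= 4 * G.
Proof.
move=> nL; have G0 : 0 <= G.
  by apply: le_trans (hG nL); exact: l2norm_ge0.
have -> : l2norm M (fun l => S n.+1 (l + s n)%N - S n.+1 l) =
    l2norm M (fun l => \sum_(k < n.+1) (g k (l + s n)%N - g k l)).
  by apply: eq_l2norm => l; rewrite sumrB.
apply: le_trans (l2norm_sum _ _ _ _) _.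
apply: (@le_trans _ _ (\sum_(k < n.+1) 2 * (G * (2 ^+ k / 2 ^+ n)))).
  apply: ler_sum => k _; pose d l := h k l - h k (l + s n)%N.
  have dM l : d (l + M)%N = d l by rewrite /d hM addnAC hM.
  have -> : l2norm M (fun l => g k (l + s n)%N - g k l) =
      l2norm M (fun l => d (l + s k)%N - d l).
    apply: eq_l2norm => l; rewrite /g /d [(l + s n + _)%N]addnAC !opprB.
    by rewrite addrACA [RHS]addrACA [_ + - h k l]addrC; congr (_ + _); rewrite addrC.
  apply: le_trans (l2normB _ _ _) _; rewrite l2norm_shift//.
  have kn : (k <= n < L)%N by rewrite nL andbT -ltnS.
  have := hs kn; rewrite -/d; lra.
rewrite -mulr_sumr -mulr_sumr -mulr_suml.
have e : \sum_(i < n.+1) 2 ^+ i = 2 ^+ n.+1 - 1 :> R.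
  by have := subrX1 (2 : R) n.+1 => ->; rewrite (_ : 2 - 1 = 1) ?mul1r//; lra.
have p : 0 < 2 ^+ n :> R by rewrite exprn_gt0.
rewrite e exprS mulrBl mul1r mulfK ?gt_eqF//.
have : 0 <= G * (2 ^+ n)^-1 by rewrite mulr_ge0// invr_ge0 ltW.
lra.
Qed.

Let S_step n : (n < L)%N ->
  l2norm M (S n.+1) ^+ 2 <= l2norm M (S n) ^+ 2 + 8 * c * G ^+ 2.
Proof.
case: JP => JD Juu Jle Jlip nL.
have JB u v w : J u (v - w) = J u v - J u w.
  by apply/eqP; rewrite eq_sym subr_eq -JD subrK.
have G0 : 0 <= G by apply: le_trans (hG nL); exact: l2norm_ge0.
(* From a^2 <= a b + e and (a - b)^2 >= 0 follows a^2 <= b^2 + 2 e. The coefficient of b^2 is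
   exactly 1, so the increments add up linearly in n. *)
suff : l2norm M (S n.+1) ^+ 2 <= l2norm M (S n.+1) * l2norm M (S n) + 4 * c * G ^+ 2.
  move: (l2norm M _) (l2norm M _) => a b; have := sqr_ge0 (a - b); nra.
rewrite {1}sqr_l2norm; under eq_bigr do rewrite -Juu.
under eq_bigr do rewrite {2}/S big_ord_recr /= -/(S n _) JD {2}/g JB.
rewrite big_split /=; apply: lerD.
  apply: le_trans (sum_rnormM_le _ _ _); apply: ler_sum => l _; exact: Jle.
(* Translating the first sum pairs both terms with the same vector [h n (l + s n)]. *)
rewrite sumrB -(@sum_periodic_shift _ M (fun l => J (S n.+1 l) (h n l)) (s n)); last first.
  by move=> l; rewrite hM SM.
rewrite -sumrB.
apply: (@le_trans _ _ (\sum_(l < M) c *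
    (rnorm (S n.+1 (l + s n)%N - S n.+1 l) * rnorm (h n (l + s n)%N)))).
  by apply: ler_sum => l _; rewrite mulrA (le_trans (ler_norm _))// Jlip.
rewrite -mulr_sumr.
rewrite [leRHS](_ : _ = c * (4 * G * G)); last by ring.
apply: ler_wpM2l => //.
apply: le_trans (sum_rnormM_le M (fun l => S n.+1 (l + s n)%N - S n.+1 l)
  (fun l => h n (l + s n)%N)) _.
apply: ler_pM; rewrite ?l2norm_ge0 ?S_shift//.
by rewrite l2norm_shift// hG.
Qed.

Lemma lacunary_l2norm :
  l2norm M (fun l => \sum_(j < L) (h j l - h j (l + s j)%N)) ^+ 2 <=
  8 * c * G ^+ 2 * L%:R.
Proof.
suff : forall n, (n <= L)%N -> l2norm M (S n) ^+ 2 <= 8 * c * G ^+ 2 * n%:R.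
  by apply.
elim=> [|n IH] nL.
  rewrite (_ : l2norm M _ = 0) ?expr0n ?mulr0//.
  by rewrite -[RHS](@l2norm0 R Y M); apply: eq_l2norm => l; rewrite /S big_ord0.
apply: le_trans (S_step nL) _; have := IH (ltnW nL); rewrite -natr1; lra.
Qed.

End smooth_space.

(** * Power bounds from lacunary blocks *)

Section lacunary_kernel.
Context {R : realType}.

Lemma half_le_onem_exp n k : (0 < n)%N -> (k <= n)%N ->
  1 / 2 <= (1 - (2 * n%:R)^-1) ^+ k :> R.
Proof.
move=> n0 kn.
have n1 : 1 <= n%:R :> R by rewrite (ler_nat _ 1).
have i0 : 0 < (2 * n%:R)^-1 :> R by rewrite invr_gt0; lra.
have i1 : (2 * n%:R)^-1 <= 1 :> R by rewrite invf_le1; lra.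
have := @bernoulli_onem R (2 * n%:R)^-1 n; rewrite (_ : n%:R * _ = 1 / 2); last first.
  by field; rewrite gt_eqF//; lra.
move=> h; apply: (@le_trans _ _ ((1 - (2 * n%:R)^-1) ^+ n)).
  by apply: le_trans (h _); [lra|apply/andP; split; lra].
by apply: ler_wiXn2l => //; lra.
Qed.

(** For q <= k < 3q, the middle half of the period 4q, the cosine is nonpositive: each of these 2q
    terms is at least (1/2)^3, and all the others are nonnegative. The weight is 1 in the smooth
    case and a Fejer weight in the dual case. *)
Lemma lacunary_kernel_ge N q (w : nat -> R) : (0 < q)%N -> (4 * q <= N)%N ->
    (forall k, 0 <= w k) -> (forall k, (k <= 3 * q)%N -> 1 / 2 <= w k) ->
  q%:R / 4 <= \sum_(k < N.+1) (1 - (2 * N%:R)^-1) ^+ (N - k) *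
    (1 - (2 * (4 * q)%:R)^-1) ^+ k * w k * (1 - Re (croot (4 * q) ^+ k)) :> R.
Proof.
move=> q0 qN w0 w1; 
pose F k : R := (1 - (2 * N%:R)^-1) ^+ (N - k) *
  (1 - (2 * (4 * q)%:R)^-1) ^+ k * w k * (1 - Re (croot (4 * q) ^+ k)).
have N0 : (0 < N)%N by lia.
have fac0 n : (0 < n)%N -> 0 <= 1 - (2 * n%:R)^-1 :> R.
  move=> n0; have := @half_le_onem_exp n 1 n0 n0; rewrite expr1; lra.
have F0 k : 0 <= F k.
  rewrite /F !mulr_ge0 ?exprn_ge0 ?fac0//; first lia.
  by rewrite subr_ge0 (le_trans (Re_le_rnorm _))// rnorm_crootX.
rewrite -[leRHS](big_mkord xpredT F).
rewrite (@big_cat_nat _ _ _ q)//=; last lia.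
rewrite (@big_cat_nat _ _ _ (3 * q) q)//=; [|lia|lia].
rewrite addrCA -[leLHS]addr0; apply: lerD; last first.
  by rewrite addr_ge0// sumr_ge0// => k _; exact: F0.
apply: (@le_trans _ _ (\sum_(q <= k < 3 * q) 1 / 8)).
  rewrite sumr_const_nat (_ : (3 * q - q)%N = (2 * q)%N); last by lia.
  by rewrite -[leRHS]mulr_natr natrM le_eqVlt; apply/orP; left; apply/eqP; field.
apply: ler_sum_nat => k /andP[qk kq].
have a1 : 1 / 2 <= (1 - (2 * N%:R)^-1) ^+ (N - k) :> R.
  by apply: half_le_onem_exp => //; exact: leq_subr.
have a2 : 1 / 2 <= (1 - (2 * (4 * q)%:R)^-1) ^+ k :> R.
  by apply: half_le_onem_exp => //; lia.
have a3 : 1 / 2 <= w k by apply: w1; lia.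
have a4 : 1 <= 1 - Re (croot (4 * q) ^+ k) :> R.
  by rewrite lerBrDr gerDl Re_croot_le0//; lia.
rewrite /F; set x1 := _ ^+ (N - k) in a1 *; set x2 := _ ^+ k in a2 *.
have p1 : 1 / 4 <= x1 * x2 by nra.
have p2 : 1 / 8 <= x1 * x2 * w k by nra.
apply: (le_trans p2); rewrite ler_peMr//; lra.
Qed.

End lacunary_kernel.


(** [beta] models the real part of a duality bracket and [nu x] a functional norming x, scaled by
    the norm of x. *)
Definition norming_pairing (R : realType) (V Y : normedModType R[i])
    (beta : V -> Y -> R) (nu : V -> Y) : Prop :=
  [/\ forall y, {morph beta^~ y : x x' / x + x'},
      forall x, {morph beta x : y y' / y + y'},
      forall x y (a : R), beta x (a%:C *: y) = a * beta x y,
      forall x y, beta x y <= rnorm x * rnorm y &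
      forall x, rnorm (nu x) <= rnorm x /\ beta x (nu x) = rnorm x ^+ 2].

Section lacunary_resolvents.
Context {R : realType} {V : normedModType R[i]} (T : {linear V -> V}).
Implicit Types x : V.
Context (t C : R).
Hypothesis t0 : 0 <= t.
Hypothesis Tt : forall x, rnorm (T x) <= t * rnorm x.
Hypothesis C0 : 0 <= C.
Hypothesis TC : forall z x, rnorm z < 1 ->
  (1 - rnorm z) * rnorm x <= C * rnorm (x - z *: T x).

(** The order of the rotation tau_j. The factor 4 makes 2 ^ j a quarter of the period, as in
    [lacunary_kernel_ge]. *)
Definition block (j : nat) : nat := 2 ^ j.+2.
(** A compromise: 1 - r = 1/(2n) keeps the Kreiss bound of order n, while r ^+ k >= 1/2 for all k <=
    n. *)
Definition disk_radius n : R := 1 - (2 * n%:R)^-1.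

Lemma block_gt0 j : (0 < block j)%N. Proof. by rewrite expn_gt0. Qed.

Lemma block_natr j : (block j)%:R = 4 * 2 ^+ j :> R.
Proof. by rewrite /block natrX !exprS mulrA -natrM. Qed.

Lemma radius01 n : (0 < n)%N -> 0 <= disk_radius n < 1.
Proof.
move=> n0; have := @half_le_onem_exp R n 1 n0 n0; rewrite expr1 -/(disk_radius n) => h.
have : 0 < (2 * n%:R)^-1 :> R by rewrite invr_gt0 mulr_gt0// ltr0n.
by rewrite /disk_radius in h *; move=> i0; apply/andP; split; lra.
Qed.

Lemma le_radius m n : (0 < m <= n)%N -> disk_radius m <= disk_radius n.
Proof.
move=> /andP[m0 mn]; rewrite lerD2l lerN2 lef_pV2 ?posrE ?mulr_gt0 ?ltr0n//.
  by rewrite ler_pM2l// ler_nat.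
exact: leq_trans mn.
Qed.

Context (L N K1 : nat).
Hypothesis K1_gt0 : (0 < K1)%N.
Hypothesis LN : (2 ^ L.+1 <= N)%N.
(** The power of 2 makes every [block j] with j < L divide K and every [shift j] a multiple of 32;
    the free factor K1 makes K as large as [decay] requires. *)
Let K := (2 ^ (L + 7) * K1)%N.
Let M := (2 * K)%N.
Hypothesis NK : (N < K)%N.
Hypothesis decay : forall x, disk_radius N ^+ K * rnorm (iter K T x) <= rnorm x.

(** On the M-th roots of unity, tau_j translates the index by [shift j]. *)
Definition shift (j : nat) : nat := 2 ^ (L + 6 - j) * K1.

Let w : R[i] := croot M.

Lemma N_gt0 : (0 < N)%N. Proof. by apply: leq_trans LN; rewrite expn_gt0. Qed.

Lemma M_gt0 : (0 < M)%N. Proof. by rewrite /M /K !muln_gt0 expn_gt0. Qed.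

Lemma block_shift j : (j < L)%N -> M = (block j * shift j)%N.
Proof.
move=> jL; rewrite /M /K /block /shift !mulnA -expnS -expnD.
by congr (2 ^ _ * _)%N; lia.
Qed.

Lemma shift_gt0 j : (0 < shift j)%N. Proof. by rewrite muln_gt0 expn_gt0. Qed.

Lemma block_le_N j : (j < L)%N -> (block j <= N)%N.
Proof. by move=> jL; apply: leq_trans LN; rewrite leq_exp2l. Qed.

Lemma croot_shift j : (j < L)%N -> w ^+ shift j = croot (block j).
Proof. by move=> jL; rewrite /w (block_shift jL) croot_divisor// shift_gt0. Qed.

(** Rotation by tau_j preserves z ^+ K, as [psum_lipschitz] demands. *)
Lemma croot_shiftK j : (j < L)%N -> (w ^+ shift j) ^+ K = 1.
Proof.
move=> jL; rewrite croot_shift//.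
have -> : K = (block j * (2 ^ (L + 5 - j) * K1))%N.
  by rewrite /K /block mulnA -expnD; congr (2 ^ _ * _)%N; lia.
by rewrite exprM croot_order ?block_gt0// expr1n.
Qed.

Lemma decay_le r x : 0 <= r <= disk_radius N -> r ^+ K * rnorm (iter K T x) <= rnorm x.
Proof.
move=> /andP[r0 rN]; apply: le_trans (decay x); apply: ler_wpM2r.
  exact: rnorm_ge0.
by rewrite lerXn2r// nnegrE// (le_trans r0).
Qed.

Lemma rnorm_radius n (u : R[i]) : (0 < n)%N -> rnorm u = 1 ->
  rnorm ((disk_radius n)%:C * u) = disk_radius n.
Proof.
move=> n0 u1; rewrite rnormM u1 mulr1 rnorm_real ger0_norm//.
by case/andP: (radius01 n0).
Qed.

Lemma psum_radius_bound n (u : R[i]) x : (0 < n <= N)%N -> rnorm u = 1 ->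
  rnorm (psum T ((disk_radius n)%:C * u) K x) <= 4 * C * n%:R * rnorm x.
Proof.
move=> /andP[n0 nN] u1; have nr := rnorm_radius n0 u1.
have /andP[r0 r1] := radius01 n0.
have := psum_bound C0 TC (z := (disk_radius n)%:C * u) (K := K) (x := x).
rewrite nr => /(_ r1) b.
have {}b := b (decay_le x (introT andP (conj r0 (le_radius (introT andP (conj n0 nN)))))).
move: b; rewrite /disk_radius opprB addrCA subrr addr0 ler_pdivrMl; last first.
  by rewrite mulr_gt0// ltr0n.
by move=> b; apply: (le_trans b); rewrite le_eqVlt; apply/orP; left; apply/eqP; ring.
Qed.

Lemma psum_radius_lipschitz n (u v : R[i]) x : (0 < n <= N)%N ->
    rnorm u = 1 -> rnorm v = 1 -> v ^+ K = 1 ->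
  rnorm (psum T ((disk_radius n)%:C * u) K x - psum T ((disk_radius n)%:C * (v * u)) K x) <=
  8 * C ^+ 2 * t * n%:R ^+ 2 * rnorm (v - 1) * rnorm x.
Proof.
move=> /andP[n0 nN] u1 v1 vK; have nr := rnorm_radius n0 u1.
have /andP[r0 r1] := radius01 n0.
have vu1 : rnorm (v * u) = 1 by rewrite rnormM u1 v1 mulr1.
have := psum_lipschitz t0 Tt C0 TC (z := (disk_radius n)%:C * u)
  (z' := (disk_radius n)%:C * (v * u)) (K := K) (x := x).
rewrite nr => /(_ r1) b.
have rN := le_radius (introT andP (conj n0 nN)).
have {}b := b (rnorm_radius n0 vu1) _ (decay_le x (introT andP (conj r0 rN))).
have {}b := b (_ : ((disk_radius n)%:C * (v * u)) ^+ K = _).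
have {}b : (1 - disk_radius n) ^+ 2 *
    rnorm (psum T ((disk_radius n)%:C * u) K x - psum T ((disk_radius n)%:C * (v * u)) K x) <=
    2 * C ^+ 2 * t * rnorm ((disk_radius n)%:C * u - (disk_radius n)%:C * (v * u)) * rnorm x.
  by apply: b; rewrite mulrCA exprMn vK mul1r.
have d : rnorm ((disk_radius n)%:C * u - (disk_radius n)%:C * (v * u)) <= rnorm (v - 1).
  rewrite (_ : _ - _ = - ((disk_radius n)%:C * u * (v - 1))); last by ring.
  by rewrite rnormN rnormM nr ler_piMl ?rnorm_ge0// ltW.
have n0' : 0 < n%:R :> R by rewrite ltr0n.
move: b; rewrite (_ : 1 - disk_radius n = (2 * n%:R)^-1); last by rewrite /disk_radius; ring.
rewrite exprVn ler_pdivrMl ?exprn_gt0 ?mulr_gt0// => b.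
apply: (le_trans b); rewrite exprMn.
apply: (@le_trans _ _ (2 ^+ 2 * n%:R ^+ 2 * (2 * C ^+ 2 * t * rnorm (v - 1) * rnorm x))).
  apply: ler_wpM2l; first by rewrite mulr_ge0// sqr_ge0.
  apply: ler_wpM2r; first exact: rnorm_ge0.
  by apply: ler_wpM2l => //; rewrite !mulr_ge0// sqr_ge0.
by rewrite le_eqVlt; apply/orP; left; apply/eqP; ring.
Qed.

(** * Power bound in a smooth space *)

Section smooth.
Context (J : V -> V -> R) (c : R).
Hypothesis c0 : 0 <= c.
Hypothesis JP : smooth_duality J c.
Hypothesis L_gt0 : (0 < L)%N.

Lemma smooth_power_bound_period x :
  Num.sqrt L%:R * rnorm (iter N T x) <=
  128 * C * (2 * C + 32 * C ^+ 2 * t) * Num.sqrt (8 * c) * N%:R * rnorm x.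
Proof.
pose q j := block j; have q0 j : 0 < (q j)%:R :> R by rewrite ltr0n block_gt0.
pose h j l := (((2 * (q j)%:R)^-1 : R)%:C) *: psum T ((disk_radius (q j))%:C * w ^+ l) K x.
(* Relative to |x|, [2 * C] bounds the size of h j and the other term its variation under rotation;
   one constant serves both [hG] and [hs]. *)
pose B := 2 * C + 32 * C ^+ 2 * t.
have B1 : 0 <= 32 * C ^+ 2 * t by rewrite !mulr_ge0// sqr_ge0.
have B0 : 0 <= B * rnorm x.
  by rewrite mulr_ge0 ?rnorm_ge0// addr_ge0// mulr_ge0.
pose G := Num.sqrt M%:R * (B * rnorm x).
have qN j : (j < L)%N -> (0 < q j <= N)%N by move=> jL; rewrite block_gt0 block_le_N.
have inq j : rnorm (((2 * (q j)%:R)^-1 : R)%:C) = (2 * (q j)%:R)^-1.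
  by rewrite rnorm_real ger0_norm// invr_ge0 mulr_ge0// ltW.
have hM j l : h j (l + M)%N = h j l.
  by rewrite /h exprD croot_order ?M_gt0// mulr1.
have hG j : (j < L)%N -> l2norm M (h j) <= G.
  move=> jL; apply: l2norm_le => // l; rewrite /h rnormZ inq ler_pdivrMl ?mulr_gt0//.
  apply: le_trans (psum_radius_bound _ (qN j jL) (rnorm_crootX _ _)) _.
  rewrite /B !mulrA; apply: ler_wpM2r; first exact: rnorm_ge0.
  by have := mulr_ge0 (ltW (q0 j)) B1; lra.
have hs k j : (k <= j < L)%N ->
    l2norm M (fun l => h k l - h k (l + shift j)%N) <= G * (2 ^+ k / 2 ^+ j).
  move=> /andP[kj jL]; have kL : (k < L)%N by apply: leq_ltn_trans jL.
  have p2 n : 0 < 2 ^+ n :> R by rewrite exprn_gt0.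
  have p0 : 0 <= 2 ^+ k / 2 ^+ j :> R by rewrite divr_ge0// ltW.
  rewrite /G -mulrA; apply: l2norm_le => [|l]; first by rewrite mulr_ge0.
  rewrite /h -scalerBr rnormZ inq ler_pdivrMl ?mulr_gt0//.
  rewrite [(l + _)%N]addnC exprD.
  apply: le_trans (psum_radius_lipschitz _ (qN k kL) (rnorm_crootX _ _)
    (rnorm_crootX _ _) (croot_shiftK jL)) _.
  have sM : (shift j)%:R / M%:R = ((q j)%:R)^-1 :> R.
    rewrite (block_shift jL) natrM; field.
    by rewrite !pnatr_eq0 -!lt0n shift_gt0 block_gt0.
  have := @rnorm_crootB1 R M (shift j); rewrite sM -/w => b.
  rewrite [leRHS](_ : _ = 2 * (q k)%:R * B * (2 ^+ k / 2 ^+ j) * rnorm x); last by ring.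
  apply: ler_wpM2r; first exact: rnorm_ge0.
  have D0 : 0 <= 8 * C ^+ 2 * t * (q k)%:R ^+ 2.
    by rewrite !mulr_ge0// sqr_ge0.
  apply: (le_trans (ler_wpM2l D0 b)).
  apply: (@le_trans _ _ (2 * (q k)%:R * (32 * C ^+ 2 * t) * (2 ^+ k / 2 ^+ j))).
    rewrite le_eqVlt; apply/orP; left; apply/eqP.
    by rewrite /q !block_natr; field; rewrite gt_eqF.
  apply: ler_wpM2r => //; rewrite ler_pM2l ?mulr_gt0// /B lerDr mulr_ge0//.
have key := lacunary_l2norm c0 JP hM hG hs.
set S := (fun l => _) in key.
(* The scalar multiplying T^N x, up to M: rotating h j by tau_j multiplies its k-th coefficient by
   [croot (q j) ^+ k]. *)
pose Lam := \sum_(j < L) ((2 * (q j)%:R)^-1 : R)%:C *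
  \sum_(k < N.+1) (disk_radius N)%:C ^+ (N - k) * (disk_radius (q j))%:C ^+ k *
    (1 - croot (q j) ^+ k).
have extr : \sum_(l < M) w ^+ (l * (M - N)) *:
    psum T ((disk_radius N)%:C * w ^+ l) K (S l) = (M%:R * Lam) *: iter N T x.
  have step (j : 'I_L) : \sum_(l < M) w ^+ (l * (M - N)) *:
      psum T ((disk_radius N)%:C * w ^+ l) K (h j l - h j (l + shift j)%N) =
      (M%:R * (((2 * (q j)%:R)^-1 : R)%:C *
  \sum_(k < N.+1) (disk_radius N)%:C ^+ (N - k) * (disk_radius (q j))%:C ^+ k *
    (1 - croot (q j) ^+ k))) *: iter N T x.
    have e := psum_extraction T (disk_radius N)%:C (disk_radius (q j))%:C x NK (leqnn M).
    have e' := psum_extraction T (disk_radius N)%:C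
      ((disk_radius (q j))%:C * croot (q j)) x NK (leqnn M).
    transitivity (((2 * (q j)%:R)^-1 : R)%:C *: (
      \sum_(l < M) w ^+ (l * (M - N)) *: psum T ((disk_radius N)%:C * w ^+ l) K
         (psum T ((disk_radius (q j))%:C * w ^+ l) K x)
      - \sum_(l < M) w ^+ (l * (M - N)) *: psum T ((disk_radius N)%:C * w ^+ l) K
         (psum T ((disk_radius (q j))%:C * croot (q j) * w ^+ l) K x))).
      rewrite -sumrB scaler_sumr; apply: eq_bigr => l _.
      rewrite /h exprD croot_shift// -scalerBr linearZ -scalerBr -linearB /=.
      by rewrite !scalerA mulrC [w ^+ l * _]mulrC mulrA.
    rewrite e e' -scalerBl scalerA -mulrBr -sumrB mulrCA; congr (_ * (_ * _) *: _).
    by apply: eq_bigr => k _; rewrite exprMn; ring.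
  rewrite /Lam mulr_sumr scaler_suml -(eq_bigr _ (fun j _ => step j)).
  rewrite exchange_big /=; apply: eq_bigr => l _.
  by rewrite /S [psum _ _ _ _]linear_sum scaler_sumr.
(* Each j contributes 1/32 at least: the normalization 1/(8 * 2^j) times the kernel bound 2^j / 4.
   Passing to real parts excludes cancellation. *)
have LamG : L%:R / 32 <= rnorm Lam.
  apply: le_trans (Re_le_rnorm _).
  have ReC (a : R) (z : R[i]) : Re (a%:C * z) = a * Re z.
    by case: z => u v /=; rewrite mul0r subr0.
  rewrite raddf_sum /= mulr_natl -[L in leLHS]card_ord -sumr_const.
  apply: ler_sum => j _; have jL := ltn_ord j.
  have qE : q j = (4 * 2 ^ j)%N by rewrite /q /block !expnS mulnA.
  have b : (2 ^ j)%:R / 4 <= \sum_(k < N.+1) disk_radius N ^+ (N - k) *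
      disk_radius (q j) ^+ k * 1 * (1 - Re (croot (q j) ^+ k)).
    rewrite /disk_radius qE; apply: (@lacunary_kernel_ge R N (2 ^ j) (fun=> 1)) => //.
    - by rewrite expn_gt0.
    - by rewrite -qE block_le_N.
    - by move=> k _; lra.
  rewrite ReC raddf_sum /= ler_pdivlMl ?mulr_gt0//.
  apply: le_trans (le_trans b _).
  - by rewrite qE natrM; lra.
  - rewrite le_eqVlt; apply/orP; left; apply/eqP; apply: eq_bigr => k _.
    by rewrite -!rmorphXn -rmorphM ReC mulr1 raddfB.
have Lp : 0 < Num.sqrt L%:R :> R by rewrite sqrtr_gt0 ltr0n.
have M0 : 0 < M%:R :> R by rewrite ltr0n M_gt0.
set y := rnorm (iter N T x).
have up : (M%:R * rnorm Lam) * y <= 4 * C * N%:R * (Num.sqrt M%:R * l2norm M S).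
  rewrite -{1}(rnorm_nat M) -rnormM -rnormZ -extr.
  apply: le_trans (ler_rnorm_sum _ _ _) _.
  apply: (@le_trans _ _ (4 * C * N%:R * \sum_(l < M) rnorm (S l))); last first.
    by apply: ler_wpM2l; [rewrite !mulr_ge0|exact: sum_rnorm_le].
  rewrite mulr_sumr; apply: ler_sum => l _; rewrite rnormZ rnorm_crootX mul1r.
  by apply: psum_radius_bound; rewrite ?rnorm_crootX ?N_gt0 /=.
have Sle : l2norm M S <= Num.sqrt (8 * c) * Num.sqrt L%:R * G.
  have G0 : 0 <= G by rewrite mulr_ge0.
  rewrite -ler_sqr ?nnegrE ?l2norm_ge0 ?(mulr_ge0 _ G0) ?mulr_ge0 ?sqrtr_ge0//.
  rewrite 2!exprMn (@sqr_sqrtr _ (8 * c)) ?mulr_ge0// (@sqr_sqrtr _ L%:R)//.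
  by apply: (le_trans key); rewrite mulrAC.
have y0 : 0 <= y by exact: rnorm_ge0.
rewrite -(ler_pM2l (_ : 0 < M%:R * Num.sqrt L%:R / 32)); last first.
  by rewrite divr_gt0// mulr_gt0.
apply: (@le_trans _ _ (M%:R * rnorm Lam * y)).
  rewrite [leLHS](_ : _ = M%:R * (Num.sqrt L%:R ^+ 2 / 32) * y); last first.
    by move: (M%:R : R) (Num.sqrt L%:R : R) => m sl; field.
  by rewrite sqr_sqrtr// ler_wpM2r// ler_pM2l.
apply: (le_trans up).
apply: (@le_trans _ _ (4 * C * N%:R * (Num.sqrt M%:R * (Num.sqrt (8 * c) * Num.sqrt L%:R * G)))).
  by apply: ler_wpM2l; [rewrite !mulr_ge0|rewrite ler_wpM2l// sqrtr_ge0].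
rewrite /G le_eqVlt; apply/orP; left; apply/eqP.
transitivity (4 * C * N%:R * Num.sqrt (8 * c) * Num.sqrt L%:R * (B * rnorm x) * Num.sqrt M%:R ^+ 2).
  by ring.
by rewrite sqr_sqrtr// /B; field.
Qed.

End smooth.

(** * Power bound in a space normed by a smooth one *)

Section dual_smooth.
Context {Y : normedModType R[i]} (beta : V -> Y -> R) (nu : V -> Y).
Context (J : Y -> Y -> R) (c : R).
Hypothesis c0 : 0 <= c.
Hypothesis JP : smooth_duality J c.
Hypothesis betaP : norming_pairing beta nu.
Hypothesis L_gt0 : (0 < L)%N.

(** One 32nd of [shift j]: short enough that the phases of frequencies up to 3 * 2^j hardly turn
    across it, long enough that averaging over it makes h j almost invariant under much smaller
    translations. *)
Let window j := (2 ^ (L + 1 - j) * K1)%N.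

Let shift_window j : (j < L)%N -> shift j = (32 * window j)%N.
Proof.
move=> jL; rewrite /shift /window mulnA -(expnD 2 5).
by congr (2 ^ _ * _)%N; lia.
Qed.

Let window_gt0 j : (0 < window j)%N.
Proof. by rewrite muln_gt0 expn_gt0. Qed.

Implicit Types y : Y.

Let betaB x y y' : beta x (y - y') = beta x y - beta x y'.
Proof.
case: betaP => _ bD _ _ _.
by apply/eqP; rewrite eq_sym subr_eq -bD subrK.
Qed.

Let betaBl x x' y : beta (x - x') y = beta x y - beta x' y.
Proof.
case: betaP => bD _ _ _ _.
by apply/eqP; rewrite eq_sym subr_eq -bD subrK.
Qed.

Let beta0 x : beta x 0 = 0. Proof. by rewrite -(subrr 0) betaB subrr. Qed.
Let beta0l y : beta 0 y = 0. Proof. by rewrite -(subrr 0) betaBl subrr. Qed.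

Let beta_sum x (I : Type) (r : seq I) (P : pred I) (F : I -> Y) :
  beta x (\sum_(i <- r | P i) F i) = \sum_(i <- r | P i) beta x (F i).
Proof. by case: betaP => _ bD _ _ _; exact: (big_morph _ (bD x) (beta0 x)). Qed.

Let beta_suml y (I : Type) (r : seq I) (P : pred I) (F : I -> V) :
  beta (\sum_(i <- r | P i) F i) y = \sum_(i <- r | P i) beta (F i) y.
Proof.
case: betaP => bD _ _ _ _.
exact: (@big_morph _ _ (beta^~ y) _ _ _ _ (bD y) (beta0l y)).
Qed.

Let beta_shift (F : nat -> V) (g : nat -> Y) m : (m <= M)%N ->
    (forall l, F (l + M)%N = F l) -> (forall l, g (l + M)%N = g l) ->
  \sum_(l < M) beta (F l) (g (l + m)%N) =
  \sum_(l < M) beta (F (l + (M - m))%N) (g l).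
Proof.
move=> mM FM gM.
rewrite -(@sum_periodic_shift _ M (fun l => beta (F l) (g (l + m)%N)) (M - m)).
  by apply: eq_bigr => l _; rewrite -addnA subnK// gM.
by move=> l; rewrite addnAC FM gM.
Qed.

(** The pairing of F with S is estimated from both sides. From above, the bound on S gives sqrt L;
    from below, the pairing is a sum of L terms [f j / window j], each of which controls |T^N x| by
    another coefficient extraction. *)
Lemma dual_power_bound_period x :
  Num.sqrt L%:R * rnorm (iter N T x) <=
  (128 * C) ^+ 2 * Num.sqrt (8 * c) * N%:R * rnorm x.
Proof.
case: betaP => _ _ betaZ beta_le nuP.
have nu_le z : rnorm (nu z) <= rnorm z by case: (nuP z).
have beta_nu z : beta z (nu z) = rnorm z ^+ 2 by case: (nuP z).
(* The scalar factor moves frequency N to 0, so that differences under rotations sort frequencies by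
   their distance to N. *)
pose F l := w ^+ (l * (M - N)) *: psum T ((disk_radius N)%:C * w ^+ l) K x.
have wM : w ^+ M = 1 by rewrite croot_order ?M_gt0.
have FM l : F (l + M)%N = F l.
  by rewrite /F !exprM exprD wM mulr1.
have FG : l2norm M F <= Num.sqrt M%:R * (4 * C * N%:R * rnorm x).
  apply: l2norm_le => [|l]; first by rewrite mulr_ge0 ?rnorm_ge0// !mulr_ge0.
  rewrite /F rnormZ rnorm_crootX mul1r.
  by apply: psum_radius_bound; rewrite ?rnorm_crootX ?N_gt0 /=.
(* Up to the factor 1 / window j, the adjoint of the map from y j to h j minus its translate:
   pairing F with S becomes pairing Fj with y j. *)
pose Fj j l := \sum_(m < window j)
  (F (l + (M - m))%N - F (l + (M - (m + shift j)))%N).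
pose f j := l2norm M (Fj j).
(* If [f j = 0] then [y j] is [0], as it should be, because [0^-1 = 0]. *)
pose y j l := (((f j)^-1 : R)%:C) *: nu (Fj j l).
pose h j l := ((((window j)%:R)^-1 : R)%:C) *: \sum_(m < window j) y j (l + m)%N.
have f0 j : 0 <= f j by exact: l2norm_ge0.
have b0 j : 0 < (window j)%:R :> R by rewrite ltr0n.
have FjM j l : Fj j (l + M)%N = Fj j l.
  by apply: eq_bigr => m _; rewrite ![(l + M + _)%N]addnAC !FM.
have yM j l : y j (l + M)%N = y j l by rewrite /y FjM.
have ny j : l2norm M (y j) <= 1.
  rewrite /y l2normZ rnorm_real ger0_norm ?invr_ge0//.
  have le : l2norm M (fun l => nu (Fj j l)) <= f j.
    rewrite ler_wsqrtr//; apply: ler_sum => l _.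
    by rewrite ler_sqr ?nnegrE ?rnorm_ge0.
  apply: le_trans (ler_wpM2l _ le) _; first by rewrite invr_ge0.
  have [->|fj] := eqVneq (f j) 0; first by rewrite !mulr0.
  by rewrite mulVf.
have hM j l : h j (l + M)%N = h j l.
  by rewrite /h; congr (_ *: _); apply: eq_bigr => m _; rewrite addnAC yM.
have inb j : rnorm ((((window j)%:R)^-1 : R)%:C) = ((window j)%:R)^-1.
  by rewrite rnorm_real ger0_norm// invr_ge0 ltW.
have sumy n j e : l2norm M (fun l => \sum_(m < n) y j (l + (e + m))%N) <= n%:R.
  apply: le_trans (l2norm_sum _ _ _ _) _.
  rewrite -[n in leRHS]card_ord -sumr_const; apply: ler_sum => m _.
  by rewrite (@l2norm_shift _ _ M (y j) (e + m)).
have hG j : (j < L)%N -> l2norm M (h j) <= 64.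
  move=> jL; rewrite /h l2normZ inb ler_pdivrMl//.
  apply: le_trans (sumy (window j) j 0) _.
  by have := b0 j; lra.
have Mj j : (j < L)%N -> M = (32 * (block j * window j))%N.
  by move=> jL; rewrite (block_shift jL) (shift_window jL); lia.
have hs k j : (k <= j < L)%N ->
    l2norm M (fun l => h k l - h k (l + shift j)%N) <= 64 * (2 ^+ k / 2 ^+ j).
  move=> /andP[kj jL].
  (* Both window sums complete to the same sum over window k + shift j consecutive indices, so only
     two sums of shift j terms remain. Since 2 * shift j / window k = 64 * 2^(k - j), this is the
     source of the 64. *)
  have e l : h k l - h k (l + shift j)%N = ((((window k)%:R)^-1 : R)%:C) *:
      (\sum_(m < shift j) y k (l + (0 + m))%N -
       \sum_(m < shift j) y k (l + (window k + m))%N).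
    rewrite /h -scalerBr; congr (_ *: _).
    pose g m := y k (l + m)%N.
    have -> : \sum_(m < window k) y k (l + shift j + m)%N = \sum_(m < window k) g (shift j + m)%N.
      by apply: eq_bigr => m _; rewrite /g addnA.
    have := sum_ord_addn (window k) (shift j) g.
    rewrite addnC sum_ord_addn => s1.
    apply/eqP; rewrite subr_eq addrAC eq_sym subr_eq; apply/eqP.
    by rewrite s1.
  rewrite (eq_l2norm _ e) l2normZ inb ler_pdivrMl//.
  apply: le_trans (l2normB _ _ _) _.
  apply: le_trans (lerD (sumy (shift j) k 0%N) (sumy (shift j) k (window k))) _.
  have -> : (window k)%:R = (window j)%:R * (2 ^+ j / 2 ^+ k) :> R.
    have -> : window k = (window j * 2 ^ (j - k))%N.
      by rewrite /window mulnAC -expnD; congr (2 ^ _ * _)%N; lia.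
    have -> : 2 ^+ j = 2 ^+ (j - k) * 2 ^+ k :> R by rewrite -exprD subnK.
    by rewrite natrM natrX mulfK// expf_neq0// pnatr_eq0.
  rewrite (shift_window jL) natrM le_eqVlt; apply/orP; left; apply/eqP.
  by field; rewrite !expf_neq0// pnatr_eq0.
have key := lacunary_l2norm c0 JP hM hG hs.
set S := (fun l => _) in key.
have pair : \sum_(l < M) beta (F l) (S l) = \sum_(j < L) f j / (window j)%:R.
  under eq_bigr do rewrite /S beta_sum.
  rewrite exchange_big /=; apply: eq_bigr => j _; have jL := ltn_ord j.
  have mM (m : 'I_(window j)) : (m + shift j <= M)%N.
    have := ltn_ord m; rewrite (Mj j jL) (shift_window jL).
    by have : (4 <= block j)%N by [rewrite /block !expnS; have := expn_gt0 2 j; lia]; nia.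
  transitivity ((window j)%:R^-1 * \sum_(m < window j)
     (\sum_(l < M) beta (F l) (y j (l + m)%N) -
      \sum_(l < M) beta (F l) (y j (l + (m + shift j))%N))).
    under [in RHS]eq_bigr do rewrite -sumrB.
    rewrite exchange_big mulr_sumr /=; apply: eq_bigr => l _.
    rewrite betaB /h !betaZ -mulrBr !beta_sum -sumrB; congr (_ * _).
    by apply: eq_bigr => m _; rewrite -addnA [(shift j + m)%N]addnC.
  transitivity ((window j)%:R^-1 * \sum_(l < M) beta (Fj j l) (y j l)).
    congr (_ * _); under [in RHS]eq_bigr do rewrite /Fj beta_suml.
    rewrite [in RHS]exchange_big /=; apply: eq_bigr => m _.
    rewrite (beta_shift (mM m) FM (yM j)) beta_shift//; last exact: leq_trans (leq_addr _ _) (mM m).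
    by rewrite -sumrB; apply: eq_bigr => l _; rewrite betaBl.
  rewrite [RHS]mulrC; congr (_ * _).
  under eq_bigr do rewrite /y betaZ beta_nu.
  rewrite -mulr_sumr -sqr_l2norm -/(f j) expr2.
  have [->|fj] := eqVneq (f j) 0; first by rewrite !mulr0.
  by rewrite mulKf.
have up : \sum_(j < L) f j / (window j)%:R <= l2norm M F * l2norm M S.
  rewrite -pair; apply: le_trans (cauchy_schwarz_sum
    (fun l : 'I_M => rnorm (F l)) (fun l : 'I_M => rnorm (S l))).
  by apply: ler_sum => l _; exact: beta_le.
have low j : (j < L)%N -> Num.sqrt M%:R * rnorm (iter N T x) <= 64 * C * (f j / (window j)%:R).
  move=> jL; pose b := window j; pose q := block j; pose s := shift j.
  have qN : (0 < q <= N)%N by rewrite block_gt0 block_le_N.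
  have MbE : M = (32 * (q * b))%N by exact: Mj.
  have bM : (b + s <= M)%N.
    rewrite MbE /s (shift_window jL) -/b.
    by have : (4 <= q)%N by [rewrite /q /block !expnS; have := expn_gt0 2 j; lia]; nia.
  have NM : (N <= M)%N by rewrite /M; lia.
  pose rr : R[i] := (disk_radius q)%:C; pose rh : R[i] := (disk_radius N)%:C.
  (* Its rotations contribute the conjugate of [D k], those in Fj contribute [D k]; the extracted
     coefficient thus contains |D k|^2, which is nonnegative. *)
  pose A l z := \sum_(m' < b) psum T (rr * (w ^+ (M - m') * w ^+ l)) K z.
  have nA l z : rnorm (A l z) <= b%:R * (4 * C * q%:R * rnorm z).
    apply: le_trans (ler_rnorm_sum _ _ _) _.
    rewrite mulr_natl -[b in leRHS]card_ord -sumr_const; apply: ler_sum => m' _.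
    by apply: psum_radius_bound; rewrite // rnormM !rnorm_crootX mulr1.
  have ext m' e : (m' <= M)%N -> (e <= M)%N ->
      \sum_(l < M) psum T (rr * (w ^+ (M - m') * w ^+ l)) K (F (l + (M - e))%N) =
      (M%:R * \sum_(k < N.+1) rh ^+ (N - k) * rr ^+ k *
        (conjc (w ^+ (m' * k)) * w ^+ (e * k))) *: iter N T x.
    move=> mM eM.
    have := psum_extraction T (rr * w ^+ (M - m')) (rh * w ^+ (M - e)) x NK (leqnn M).
    rewrite -/w [in RHS](reindex_inj rev_ord_inj) /= => E.
    transitivity (w ^+ ((M - e) * (M - N)) *:
      ((M%:R * \sum_(k < N.+1) (rr * w ^+ (M - m')) ^+ (N - (N.+1 - k.+1)) *
          (rh * w ^+ (M - e)) ^+ (N.+1 - k.+1)) *: iter N T x)).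
      rewrite -E scaler_sumr; apply: eq_bigr => l _.
      rewrite /F linearZ /= scalerA mulnDl [(l * _ + _)%N]addnC exprD addnC exprD.
      by rewrite !mulrA.
    rewrite scalerA mulrCA mulr_sumr; congr (_ * _ *: _); apply: eq_bigr => k _.
    have kN : (k <= N)%N by rewrite -ltnS.
    rewrite subSS subKn// !exprMn croot_conjc ?M_gt0// -/w.
    (* The exponents on the right add up to (M - e) * (M - k), congruent to e * k modulo M. *)
    have -> : w ^+ (e * k) = w ^+ ((M - e) * (M - N)) * w ^+ (M - e) ^+ (N - k).
      rewrite -exprM -exprD -mulnDr (_ : M - N + (N - k) = M - k)%N; last by lia.
      transitivity (w ^+ (M * M + e * k)); first by rewrite exprD [w ^+ (M * M)]exprM wM expr1n mul1r.
      transitivity (w ^+ ((M - e) * (M - k) + M * (e + k))).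
        by congr (w ^+ _); nia.
      by rewrite exprD [w ^+ (M * _)]exprM wM expr1n mulr1.
    ring.
  pose D k := \sum_(m < b) w ^+ (m * k).
  pose W k := (rnorm (D k) / b%:R) ^+ 2.
  have extr : \sum_(l < M) A l (Fj j l) = (M%:R * \sum_(k < N.+1)
      rh ^+ (N - k) * rr ^+ k * (D k * conjc (D k)) * (1 - croot q ^+ k)) *: iter N T x.
    transitivity (\sum_(m' < b) \sum_(m < b) (M%:R * \sum_(k < N.+1)
      rh ^+ (N - k) * rr ^+ k * (conjc (w ^+ (m' * k)) * w ^+ (m * k) *
        (1 - croot q ^+ k))) *: iter N T x).
      rewrite /A exchange_big; apply: eq_bigr => m' _ /=.
      under eq_bigr do rewrite /Fj linear_sum.
      rewrite exchange_big; apply: eq_bigr => m _ /=.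
      under eq_bigr do rewrite linearB /=.
      have mb := ltn_ord m; have m'b := ltn_ord m'; have b_le : (b <= M)%N by lia.
      rewrite sumrB !ext ?(leq_trans (ltnW m'b))//; [|lia|lia].
      rewrite -scalerBl -mulrBr -sumrB; congr (_ * _ *: _); apply: eq_bigr => k _.
      rewrite mulnDl exprD -(croot_shift jL) -exprM -/w -/s; ring.
    under eq_bigr do rewrite -scaler_suml -mulr_sumr.
    rewrite -scaler_suml -mulr_sumr; congr (_ * _ *: _).
    under eq_bigr do rewrite exchange_big.
    rewrite exchange_big; apply: eq_bigr => k _ /=.
    rewrite rmorph_sum /= mulr_suml mulr_sumr mulr_suml.
    rewrite exchange_big /=; apply: eq_bigr => m _.
    rewrite !(mulr_sumr, mulr_suml); apply: eq_bigr => m' _; ring.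
  have lowsum : b%:R ^+ 2 * (q%:R / 16) <= rnorm (\sum_(k < N.+1)
      rh ^+ (N - k) * rr ^+ k * (D k * conjc (D k)) * (1 - croot q ^+ k)).
    apply: le_trans (Re_le_rnorm _).
    have ReC (a : R) (z : R[i]) : Re (a%:C * z) = a * Re z.
      by case: z => u v /=; rewrite mul0r subr0.
    have qE : q = (4 * 2 ^ j)%N by rewrite /q /block !expnS mulnA.
    have W1 k : (k <= 3 * 2 ^ j)%N -> 1 / 2 <= W k.
      move=> kj.
      (* Here m k / M <= 3/128, so by [rnorm_crootB1] each phase lies within 3/16 of 1; and
         (13/16)^2 exceeds 1/2. *)
      have : rnorm (b%:R - D k) <= b%:R * (3 / 16).
        have -> : b%:R - D k = \sum_(m < b) (1 - w ^+ (m * k)).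
          by rewrite sumrB sumr_const card_ord.
        apply: le_trans (ler_rnorm_sum _ _ _) _.
        rewrite [leRHS]mulr_natl -[b in leRHS]card_ord -sumr_const.
        apply: ler_sum => m _; rewrite rnorm_distC.
        apply: le_trans (rnorm_crootB1 _ _) _.
        rewrite -ler_pdivlMl// ler_pdivrMr ?ltr0n ?M_gt0//.
        have mb := ltn_ord m.
        have : (m * k * 128 <= 3 * M)%N.
          by rewrite MbE qE; nia.
        rewrite -(ler_nat R) !natrM; lra.
      have := rnormD (b%:R - D k) (D k); rewrite subrK rnorm_nat => h1 h2.
      have h3 : 13 / 16 <= rnorm (D k) / b%:R.
        by rewrite ler_pdivlMr ?b0// mulrC; lra.
      rewrite /W; nra.
    have bb : (2 ^ j)%:R / 4 <= \sum_(k < N.+1) disk_radius N ^+ (N - k) *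
        disk_radius q ^+ k * W k * (1 - Re (croot q ^+ k)).
      rewrite /disk_radius qE; apply: lacunary_kernel_ge => //.
      - by rewrite expn_gt0.
      - by rewrite -qE block_le_N.
      - by move=> k; exact: sqr_ge0.
    apply: (@le_trans _ _ (b%:R ^+ 2 * \sum_(k < N.+1) disk_radius N ^+ (N - k) *
        disk_radius q ^+ k * W k * (1 - Re (croot q ^+ k)))).
      apply: ler_wpM2l; first exact: sqr_ge0.
      by apply: le_trans bb; rewrite qE natrM; lra.
    rewrite raddf_sum /= mulr_sumr le_eqVlt; apply/orP; left; apply/eqP.
    apply: eq_bigr => k _.
    rewrite mul_conjc -!rmorphXn -!rmorphM ReC raddfB /= /W.
    by field; rewrite gt_eqF// b0.
  have M0 : 0 < M%:R :> R by rewrite ltr0n M_gt0.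
  have q0 : 0 < q%:R :> R by rewrite ltr0n block_gt0.
  set y0 := rnorm (iter N T x).
  have up2 : M%:R * (b%:R ^+ 2 * (q%:R / 16)) * y0 <=
      b%:R * (4 * C * q%:R) * (Num.sqrt M%:R * f j).
    apply: (@le_trans _ _ (rnorm (\sum_(l < M) A l (Fj j l)))).
      rewrite extr rnormZ rnormM rnorm_nat; apply: ler_wpM2r; first exact: rnorm_ge0.
      by rewrite ler_pM2l.
    apply: le_trans (ler_rnorm_sum _ _ _) _.
    apply: (@le_trans _ _ (b%:R * (4 * C * q%:R) * \sum_(l < M) rnorm (Fj j l))).
      by rewrite mulr_sumr; apply: ler_sum => l _; rewrite -mulrA nA.
    by apply: ler_wpM2l; [rewrite !mulr_ge0|exact: sum_rnorm_le].
  have sM : 0 < Num.sqrt M%:R :> R by rewrite sqrtr_gt0.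
  have e : M%:R = Num.sqrt M%:R ^+ 2 :> R by rewrite sqr_sqrtr.
  rewrite -(ler_pM2l (_ : 0 < b%:R ^+ 2 * (q%:R / 16) * Num.sqrt M%:R)); last first.
    by rewrite !mulr_gt0 ?invr_gt0 ?b0.
  apply: (@le_trans _ _ (M%:R * (b%:R ^+ 2 * (q%:R / 16)) * y0)).
    rewrite [in leRHS]e le_eqVlt; apply/orP; left; apply/eqP.
    by move: (Num.sqrt _ : R) (b%:R : R) (q%:R : R) => a1 a2 a3; field.
  apply: (le_trans up2); rewrite le_eqVlt; apply/orP; left; apply/eqP.
  have := b0 j; rewrite -/b; move: (Num.sqrt _ : R) (b%:R : R) (q%:R : R) => a1 a2 a3 a20.
  by field; rewrite gt_eqF.
have Lp : 0 < Num.sqrt L%:R :> R by rewrite sqrtr_gt0 ltr0n.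
have M0 : 0 < Num.sqrt M%:R :> R by rewrite sqrtr_gt0 ltr0n M_gt0.
have Sle : l2norm M S <= Num.sqrt (8 * c) * Num.sqrt L%:R * 64.
  rewrite -ler_sqr ?nnegrE ?l2norm_ge0 ?mulr_ge0 ?sqrtr_ge0//.
  rewrite 2!exprMn (@sqr_sqrtr _ (8 * c)) ?mulr_ge0// (@sqr_sqrtr _ L%:R)//.
  by apply: (le_trans key); rewrite mulrAC.
rewrite -(ler_pM2l (_ : 0 < Num.sqrt M%:R * Num.sqrt L%:R)) ?mulr_gt0//.
apply: (@le_trans _ _ (64 * C * (l2norm M F * l2norm M S))).
  apply: (@le_trans _ _ (64 * C * \sum_(j < L) f j / (window j)%:R)); last first.
    by apply: ler_wpM2l => //; rewrite mulr_ge0.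
  rewrite [leLHS](_ : _ = Num.sqrt L%:R ^+ 2 * (Num.sqrt M%:R * rnorm (iter N T x))); last first.
    by move: (Num.sqrt M%:R : R) (Num.sqrt L%:R : R) => a1 a2; ring.
  rewrite sqr_sqrtr// [leLHS]mulr_natl -[L in leLHS]card_ord -sumr_const mulr_sumr.
  by apply: ler_sum => j _; exact: low.
apply: (@le_trans _ _ (64 * C * ((Num.sqrt M%:R * (4 * C * N%:R * rnorm x)) *
    (Num.sqrt (8 * c) * Num.sqrt L%:R * 64)))).
  by apply: ler_wpM2l; [rewrite mulr_ge0|apply: ler_pM => //; exact: l2norm_ge0].
rewrite le_eqVlt; apply/orP; left; apply/eqP.
by move: (Num.sqrt M%:R : R) (Num.sqrt L%:R : R) => a1 a2; ring.
Qed.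

End dual_smooth.
End lacunary_resolvents.

(** * Duality maps of complex L^p spaces *)

Section radial_power.
Context {R : realType}.
Implicit Types (a b : R[i]) (r m n : R).

(** From ln x <= x - 1 and e^x >= 1 + x. The factor m on the left lets one inequality cover both r <
    1 and r >= 1. *)
Lemma powR_sub_le r m n : 0 <= r -> 0 < m <= n ->
  (n `^ r - m `^ r) * m <= r * n `^ r * (n - m).
Proof.
move=> r0 /andP[m0 mn]; have n0 : 0 < n by apply: lt_le_trans mn.
have nm0 : 0 < n / m by rewrite divr_gt0.
have lnle : ln (n / m) <= n / m - 1.
  by rewrite lerBrDl -[leRHS]lnK ?posrE// expR_ge1Dx.
have mr : n `^ r * (1 - r * (n / m - 1)) <= m `^ r.
  have -> : m `^ r = n `^ r * expR (- (r * ln (n / m))).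
    rewrite /powR !gt_eqF// -expRD; congr expR.
    by rewrite ln_div ?posrE//; ring.
  apply: ler_wpM2l; first exact: powR_ge0.
  apply: le_trans (expR_ge1Dx _); rewrite lerD2l lerN2.
  exact: ler_wpM2l.
have := ler_wpM2r (ltW m0) mr.
have -> : n `^ r * (1 - r * (n / m - 1)) * m = n `^ r * m - r * n `^ r * (n - m).
  by field; rewrite gt_eqF.
lra.
Qed.

(** For r = p - 2, the pointwise duality map of L^p before normalization. *)
Definition radial r a : R[i] := (rnorm a `^ r)%:C * a.

Lemma rnorm_radial r a : r + 1 != 0 -> rnorm (radial r a) = rnorm a `^ (r + 1).
Proof.
move=> r1; rewrite /radial rnormM rnorm_real ger0_norm ?powR_ge0//.
have [->|a0] := eqVneq (rnorm a) 0; first by rewrite mulr0 powR0.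
by rewrite powRD ?a0 ?implybT// powRr1// rnorm_ge0.
Qed.

Lemma radial_lipschitz r a b : 0 <= r ->
  rnorm (radial r a - radial r b) <=
  (1 + r) * (rnorm a `^ r + rnorm b `^ r) * rnorm (a - b).
Proof.
move=> r0; wlog ba : a b / rnorm b <= rnorm a => [H|].
  have [ba|ab] := leP (rnorm b) (rnorm a); first exact: H.
  by rewrite rnorm_distC [rnorm a `^ _ + _]addrC [rnorm (a - b)]rnorm_distC H// ltW.
(* The difference of powers multiplies b, the smaller number, as [powR_sub_le] requires. *)
have -> : radial r a - radial r b =
    (rnorm a `^ r)%:C * (a - b) + (rnorm a `^ r - rnorm b `^ r)%:C * b.
  by rewrite /radial rmorphB /=; ring.
apply: le_trans (rnormD _ _) _; rewrite !rnormM !rnorm_real.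
rewrite [`|rnorm a `^ r|]ger0_norm ?powR_ge0// ger0_norm; last first.
  by rewrite subr_ge0 ge0_ler_powR ?nnegrE ?rnorm_ge0.
have d0 := rnorm_ge0 (a - b).
have A0 : 0 <= rnorm a `^ r by exact: powR_ge0.
have B0 : 0 <= rnorm b `^ r by exact: powR_ge0.
have d1 : rnorm a - rnorm b <= rnorm (a - b).
  by rewrite lerBlDr; have := rnormD (a - b) b; rewrite subrK.
have : (rnorm a `^ r - rnorm b `^ r) * rnorm b <= r * rnorm a `^ r * rnorm (a - b).
  have [->|b0] := eqVneq (rnorm b) 0; first by rewrite mulr0 !mulr_ge0.
  have b1 : 0 < rnorm b <= rnorm a by rewrite lt_neqAle eq_sym b0 rnorm_ge0.
  apply: le_trans (powR_sub_le r0 b1) _; apply: ler_wpM2l => //.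
  by rewrite mulr_ge0.
have : 0 <= rnorm b `^ r * rnorm (a - b) by rewrite mulr_ge0.
have : 0 <= r * (rnorm b `^ r * rnorm (a - b)) by rewrite !mulr_ge0.
lra.
Qed.

(** The real part of a times the conjugate of b; with this bracket the duality map needs no
    conjugation. *)
Definition cdot a b : R := Re a * Re b + Im a * Im b.

Lemma abs_cdot_le a b : `|cdot a b| <= rnorm a * rnorm b.
Proof.
rewrite !rnorm_complexE -sqrtrM ?addr_ge0 ?sqr_ge0// -sqrtr_sqr ler_wsqrtr//.
rewrite /cdot -subr_ge0; move: (Re a) (Im a) (Re b) (Im b) => x y z t.
rewrite [leRHS](_ : _ = (x * t - y * z) ^+ 2) ?sqr_ge0//; ring.
Qed.

Lemma cdotDl a a' b : cdot (a + a') b = cdot a b + cdot a' b.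
Proof. by rewrite /cdot !raddfD /=; ring. Qed.

Lemma cdotDr a b b' : cdot a (b + b') = cdot a b + cdot a b'.
Proof. by rewrite /cdot !raddfD /=; ring. Qed.

Lemma cdotBr a b b' : cdot a (b - b') = cdot a b - cdot a b'.
Proof. by rewrite /cdot !raddfB /=; ring. Qed.

Lemma cdotZr r a b : cdot a (r%:C * b) = r * cdot a b.
Proof. by rewrite /cdot; case: b => u v /=; ring. Qed.

Lemma cdotaa a : cdot a a = rnorm a ^+ 2.
Proof. by rewrite rnorm_complexE sqr_sqrtr ?addr_ge0 ?sqr_ge0// /cdot !expr2. Qed.

(** Replace each factor by the largest. Integrated over functions of norm at most 1, this does the
    work of a three-factor Hoelder inequality, with constant 3. *)
Lemma powR_mul3_le r (x y z : R) : 0 <= r -> 0 <= x -> 0 <= y -> 0 <= z ->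
  x `^ r * y * z <= x `^ (r + 2) + y `^ (r + 2) + z `^ (r + 2).
Proof.
move=> r0 x0 y0 z0; pose m := Num.max x (Num.max y z).
have r2 : r + 2 != 0 by rewrite gt_eqF// ltr_wpDl.
have [xm ym zm] : [/\ x <= m, y <= m & z <= m] by rewrite /m !le_max !lexx !orbT.
have m0 : 0 <= m by apply: le_trans xm.
have mE : m `^ (r + 2) = m `^ r * m * m.
  have [->|mn] := eqVneq m 0; first by rewrite powR0// mulr0.
  by rewrite powRD ?mn ?implybT// (powR_mulrn 2)// expr2 mulrA.
apply: (@le_trans _ _ (m `^ (r + 2))).
  rewrite mE; apply: ler_pM => //; first by rewrite mulr_ge0// powR_ge0.
  apply: ler_pM => //; first exact: powR_ge0.
  by rewrite ge0_ler_powR ?nnegrE.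
have := powR_ge0 x (r + 2); have := powR_ge0 y (r + 2); have := powR_ge0 z (r + 2).
rewrite /m /Num.max; case: ifP => _; first case: ifP => _; lra.
Qed.

End radial_power.

Section cLspace_pairing.
Context d (Om : measurableType d) (R : realType) (mu : {measure set Om -> \bar R}).

Lemma cLnorm_powR p (f : Om -> R[i]) : p != 0 ->
  (cLnorm mu p f `^ p = \int[mu]_x ((rnorm (f x)) `^ p)%:E)%E.
Proof.
move=> p0; rewrite /cLnorm powR_Lnorm//; apply: eq_integral => x _ /=.
by rewrite ger0_norm ?rnorm_ge0.
Qed.

Lemma measurable_cdot (f g : Om -> R[i]) : cmeasurable_fun f -> cmeasurable_fun g ->
  measurable_fun setT (fun x => cdot (f x) (g x)).
Proof.
by move=> [fr fi] [gr gi]; apply: measurable_funD; apply: measurable_funM.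
Qed.

Lemma cmeasurable_radial r (f : Om -> R[i]) : cmeasurable_fun f ->
  cmeasurable_fun (fun x => radial r (f x)).
Proof.
move=> mf; apply: cmeasurableM => //; split => /=; last exact: measurable_cst.
by apply: (measurableT_comp (measurable_powR _)); exact: cmeasurable_rnorm.
Qed.

Section conjugate.
Context (p q : R) (p1 : 1 <= p) (q1 : 1 <= q).
Hypothesis p_gt1 : 1 < p.
Hypothesis pq : p^-1 + q^-1 = 1.

Let p0 : 0 < p. Proof. exact: lt_le_trans p1. Qed.
Let q0 : 0 < q. Proof. exact: lt_le_trans q1. Qed.

Let p1q : (p - 1) * q = p.
Proof.
have : (p^-1 + q^-1) * (p * q) = p * q by rewrite pq mul1r.
rewrite (_ : (p^-1 + q^-1) * (p * q) = q + p); last by field; rewrite !gt_eqF.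
lra.
Qed.

Let lp (f : cLfunType mu p1) := fine (cLnorm mu p f).
Let lq (g : cLfunType mu q1) := fine (cLnorm mu q g).

Lemma integral_rnorm_powR s (s1 : 1 <= s) (f : cLfunType mu s1) :
  (\int[mu]_x ((rnorm (f x)) `^ s)%:E = ((fine (cLnorm mu s f)) `^ s)%:E)%E.
Proof.
have s0 : s != 0 by rewrite gt_eqF// (lt_le_trans _ s1).
by rewrite -cLnorm_powR// -poweR_EFin fineK// cLfun_fin_num.
Qed.

Lemma cdot_hoelder (f : cLfunType mu p1) (g : cLfunType mu q1) :
  mu.-integrable setT (EFin \o (fun x => cdot (f x) (g x))) /\
  `|\int[mu]_x (cdot (f x) (g x))| <= lp f * lq g.
Proof.
have mf := cLfun_measurable f; have mg := cLfun_measurable g.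
have mc := measurable_cdot mf mg.
have le : (\int[mu]_x `|(cdot (f x) (g x))%:E| <= (lp f * lq g)%:E)%E.
  apply: (@le_trans _ _ ('N[mu]_1[EFin \o ((fun x => rnorm (f x)) \* (fun x => rnorm (g x)))%R])%E).
    rewrite Lnorm1; apply: ge0_le_integral => //.
    - by apply: measurableT_comp => //; exact/measurable_EFinP.
    - apply: measurableT_comp => //; apply/measurable_EFinP.
      by apply: measurable_funM; exact: cmeasurable_rnorm.
    - move=> x _; rewrite /= lee_fin [leRHS]ger0_norm ?mulr_ge0 ?rnorm_ge0//.
      exact: abs_cdot_le.
  rewrite EFinM !fineK ?cLfun_fin_num//.
  have mF := cmeasurable_rnorm mf; have mG := cmeasurable_rnorm mg.
  have /measurable_EFinP mFE := mF; have /measurable_EFinP mGE := mG.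
  exact: hoelder.
have int : mu.-integrable setT (EFin \o (fun x => cdot (f x) (g x))).
  apply/integrableP; split; first exact/measurable_EFinP.
  by apply: le_lt_trans le _; exact: ltry.
split=> //; rewrite -lee_fin EFin_normr_Rintegral//.
apply: le_trans le; apply: le_abse_integral => //; exact/measurable_EFinP.
Qed.

Definition pairing (u : cLspace mu p1) (v : cLspace mu q1) : R :=
  \int[mu]_x (cdot ((repr u : cLfunType mu p1) x) ((repr v : cLfunType mu q1) x)).

Lemma pairing_pi (f : cLfunType mu p1) (g : cLfunType mu q1) :
  pairing (\pi_(cLspace mu p1) f) (\pi_(cLspace mu q1) g) =
  \int[mu]_x (cdot (f x) (g x)).
Proof.
have /cLspace_eqP f' := reprK (\pi_(cLspace mu p1) f).
have /cLspace_eqP g' := reprK (\pi_(cLspace mu q1) g).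
congr fine; apply: ae_eq_integral => //.
- by apply/measurable_EFinP/measurable_cdot; exact: cLfun_measurable.
- by apply/measurable_EFinP/measurable_cdot; exact: cLfun_measurable.
- by apply: filterS2 f' g' => x fx gx _; rewrite fx gx.
Qed.

Lemma pairing_le u v : `|pairing u v| <= rnorm u * rnorm v.
Proof.
elim/cLspaceW: u => f; elim/cLspaceW: v => g.
by rewrite pairing_pi !cLspace_rnormE; case: (cdot_hoelder f g).
Qed.

Lemma pairingDl v : {morph pairing^~ v : u u' / u + u'}.
Proof.
move=> u u'; elim/cLspaceW: u => f; elim/cLspaceW: u' => f'; elim/cLspaceW: v => g.
rewrite -cLspace_piD !pairing_pi -RintegralD//;
  [|by case: (cdot_hoelder f g)|by case: (cdot_hoelder f' g)].
by apply: eq_Rintegral => x _; rewrite -cdotDl.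
Qed.

Lemma pairingDr u : {morph pairing u : v v' / v + v'}.
Proof.
move=> v v'; elim/cLspaceW: u => f; elim/cLspaceW: v => g; elim/cLspaceW: v' => g'.
rewrite -cLspace_piD !pairing_pi -RintegralD//;
  [|by case: (cdot_hoelder f g)|by case: (cdot_hoelder f g')].
by apply: eq_Rintegral => x _; rewrite -cdotDr.
Qed.

Lemma pairingZr u v (a : R) : pairing u (a%:C *: v) = a * pairing u v.
Proof.
elim/cLspaceW: u => f; elim/cLspaceW: v => g.
rewrite -cLspace_piZ !pairing_pi -RintegralZl//; last by case: (cdot_hoelder f g).
by apply: eq_Rintegral => x _; rewrite -cdotZr.
Qed.

Lemma cLnorm_radial (f : cLfunType mu p1) :
  cLnorm mu q (fun x => radial (p - 2) (f x)) = ((lp f) `^ (p - 1))%:E.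
Proof.
have E : (cLnorm mu q (fun x => radial (p - 2) (f x)) `^ q =
    ((lp f) `^ p)%:E)%E.
  rewrite cLnorm_powR ?gt_eqF// -integral_rnorm_powR; apply: eq_integral => x _.
  have p2 : p - 2 + 1 = p - 1 by ring.
  rewrite rnorm_radial p2; last by rewrite gt_eqF// subr_gt0.
  by rewrite -powRrM p1q.
have := congr1 (fun e => e `^ q^-1)%E E.
rewrite -poweRrM mulfV ?gt_eqF// poweRe1 ?cLnorm_ge0// => ->.
by rewrite poweR_EFin -powRrM -[X in X * _]p1q mulfK ?gt_eqF.
Qed.

Lemma radial_cLfun (f : cLfunType mu p1) :
  (fun x => radial (p - 2) (f x)) \in cLfun mu q.
Proof.
apply/cLfunP; split; first exact/cmeasurable_radial/cLfun_measurable.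
by rewrite cLnorm_radial ltry.
Qed.

Definition duality_fun (f : cLfunType mu p1) : cLfunType mu q1 := CLfun q1 (radial_cLfun f).

(** The power of the norm in front makes the map homogeneous of degree 1, so that pairing with u
    gives |u|^2. *)
Definition duality_map (u : cLspace mu p1) : cLspace mu q1 :=
  ((rnorm u) `^ (2 - p))%:C *: \pi_(cLspace mu q1) (duality_fun (repr u)).

Lemma pairing_radial u :
  pairing u (\pi_(cLspace mu q1) (duality_fun (repr u))) = rnorm u `^ p.
Proof.
rewrite -{1}(reprK u) pairing_pi.
have -> : rnorm u = lp (repr u) by rewrite -{1}(reprK u) cLspace_rnormE.
rewrite -[RHS]/(fine ((lp (repr u)) `^ p)%:E) -integral_rnorm_powR.
congr fine; apply: eq_integral => x _; congr EFin.
rewrite cdotZr cdotaa; set n := rnorm _.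
have [->|n0] := eqVneq n 0; first by rewrite expr0n mulr0 powR0// gt_eqF.
by rewrite -powR_mulrn ?rnorm_ge0// -powRD ?n0 ?implybT// subrK.
Qed.

Lemma rnorm_duality_map u : rnorm (duality_map u) <= rnorm u.
Proof.
rewrite /duality_map rnormZ rnorm_real ger0_norm ?powR_ge0//.
rewrite cLspace_rnormE cLnorm_radial /=.
have -> : lp (repr u) = rnorm u by rewrite -[in RHS](reprK u) cLspace_rnormE.
have [->|n0] := eqVneq (rnorm u) 0.
  by rewrite [X in _ * X]powR0 ?mulr0// gt_eqF// subr_gt0.
rewrite -powRD ?n0 ?implybT// (_ : 2 - p + (p - 1) = 1) ?powRr1 ?rnorm_ge0//.
ring.
Qed.

Lemma pairing_duality_map u : pairing u (duality_map u) = rnorm u ^+ 2.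
Proof.
rewrite /duality_map pairingZr pairing_radial.
have [->|n0] := eqVneq (rnorm u) 0.
  by rewrite [X in _ * X]powR0 ?mulr0 ?expr0n// gt_eqF.
by rewrite -powRD ?n0 ?implybT// subrK powR_mulrn// rnorm_ge0.
Qed.

Lemma pairing_norming : norming_pairing pairing duality_map.
Proof.
split.
- exact: pairingDl.
- exact: pairingDr.
- exact: pairingZr.
- by move=> u v; apply: le_trans (pairing_le u v); exact: ler_norm.
- by move=> u; split; [exact: rnorm_duality_map|exact: pairing_duality_map].
Qed.

(** * Lipschitz continuity of the duality map for p >= 2 *)

Section two_le.
Hypothesis p_ge2 : 2 <= p.
Let r := p - 2.
Let r0 : 0 <= r. Proof. by rewrite subr_ge0. Qed.

Let lpE (f : cLfunType mu p1) : lp f = rnorm (\pi_(cLspace mu p1) f).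
Proof. by rewrite cLspace_rnormE. Qed.

Let mul3 (f h g : Om -> R[i]) x := rnorm (f x) `^ r * rnorm (h x) * rnorm (g x).

Let mul3_ge0 f h g x : 0 <= mul3 f h g x.
Proof. by rewrite /mul3 !mulr_ge0 ?powR_ge0 ?rnorm_ge0. Qed.

Let measurable_mul3 (f h g : cLfunType mu p1) :
  measurable_fun setT (fun x => (mul3 f h g x)%:E).
Proof.
apply/measurable_EFinP; apply: measurable_funM; last first.
  exact/cmeasurable_rnorm/cLfun_measurable.
apply: measurable_funM; last exact/cmeasurable_rnorm/cLfun_measurable.
apply: (measurableT_comp (measurable_powR _)).
exact/cmeasurable_rnorm/cLfun_measurable.
Qed.

Let measurable_rnorm_powR (f : cLfunType mu p1) :
  measurable_fun setT (fun x => (rnorm (f x) `^ p)%:E).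
Proof.
apply/measurable_EFinP; apply: (measurableT_comp (measurable_powR _)).
exact/cmeasurable_rnorm/cLfun_measurable.
Qed.

Let integral_mul3_le3 (f h g : cLfunType mu p1) : lp f <= 1 -> lp h <= 1 -> lp g <= 1 ->
  (\int[mu]_x (mul3 f h g x)%:E <= 3%:E)%E.
Proof.
have le1 (k : cLfunType mu p1) : lp k <= 1 -> (\int[mu]_x (rnorm (k x) `^ p)%:E <= 1%:E)%E.
  move=> k1; rewrite integral_rnorm_powR lee_fin.
  apply: (@le_trans _ _ (1 `^ p)); last by rewrite powR1.
  have k0 : 0 <= lp k by rewrite lpE rnorm_ge0.
  by rewrite ge0_ler_powR ?nnegrE ?(ltW p0).
move=> f1 h1 g1.
apply: (@le_trans _ _ (\int[mu]_x ((rnorm (f x) `^ p)%:E + (rnorm (h x) `^ p)%:E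
    + (rnorm (g x) `^ p)%:E))%E).
  apply: ge0_le_integral => //.
  - by move=> x _; rewrite lee_fin mul3_ge0.
  - by apply: emeasurable_funD => //; exact: emeasurable_funD.
  - move=> x _; rewrite -!EFinD lee_fin.
    have := @powR_mul3_le R r _ _ _ r0 (rnorm_ge0 (f x)) (rnorm_ge0 (h x)) (rnorm_ge0 (g x)).
    by rewrite /r subrK.
have P0 (k : cLfunType mu p1) x : (0 <= (rnorm (k x) `^ p)%:E)%E.
  by rewrite lee_fin powR_ge0.
rewrite ge0_integralD//; [|by move=> x _; rewrite adde_ge0|exact: emeasurable_funD].
rewrite ge0_integralD//.
rewrite (_ : 3%:E = 1%:E + 1%:E + 1%:E)%E; last by rewrite -!EFinD; congr EFin; ring.
by rewrite !leeD// le1.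
Qed.

(** By homogeneity, dividing by A, B and D reduces to norms at most 1. *)
Let integral_mul3_le (f h g : cLfunType mu p1) A B D : 0 < A -> 0 < B -> 0 < D ->
    lp f <= A -> lp h <= B -> lp g <= D ->
  (\int[mu]_x (mul3 f h g x)%:E <= (3 * (A `^ r * B * D))%:E)%E.
Proof.
move=> A0 B0 D0 fA hB gD.
have sc (k : cLfunType mu p1) (a : R) : 0 < a -> lp k <= a -> lp ((a^-1)%:C *: k) <= 1.
  move=> a0 ka; rewrite lpE cLspace_piZ rnormZ -lpE rnorm_real ger0_norm ?invr_ge0 ?(ltW a0)//.
  by rewrite ler_pdivrMl// mulr1.
have sx (k : cLfunType mu p1) (a : R) x : 0 < a ->
    rnorm (k x) = a * rnorm (((a^-1)%:C *: k : cLfunType mu p1) x).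
  move=> a0; rewrite -[((a^-1)%:C *: k : cLfunType mu p1) x]/((a^-1)%:C * k x).
  rewrite rnormM rnorm_real ger0_norm ?invr_ge0 ?(ltW a0)//.
  by rewrite mulVKf// gt_eqF.
have k0 : 0 <= A `^ r * B * D by rewrite !mulr_ge0 ?powR_ge0 ?(ltW B0) ?(ltW D0).
have -> : (\int[mu]_x (mul3 f h g x)%:E = (A `^ r * B * D)%:E *
    \int[mu]_x (mul3 ((A^-1)%:C *: f : cLfunType mu p1) ((B^-1)%:C *: h : cLfunType mu p1)
      ((D^-1)%:C *: g : cLfunType mu p1) x)%:E)%E.
  rewrite -ge0_integralZl_EFin//; last by move=> x _; rewrite lee_fin mul3_ge0.
  apply: eq_integral => x _; rewrite -EFinM; congr EFin.
  rewrite /mul3 (sx f A x A0) (sx h B x B0) (sx g D x D0) powRM ?rnorm_ge0 ?(ltW A0)//.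
  ring.
rewrite (_ : (3 * (A `^ r * B * D))%:E = (A `^ r * B * D)%:E * 3%:E)%E; last first.
  by rewrite -EFinM mulrC.
apply: lee_wpmul2l; first by rewrite lee_fin.
by apply: integral_mul3_le3; exact: sc.
Qed.

(** [radial_lipschitz] produces two triple products; as lp f' <= lp f, the same bound with constant
    3 applies to both. *)
Let duality_fun_lipschitz (f f' g : cLfunType mu p1) : 0 < lp f -> lp f' <= lp f ->
    0 < lp (f - f') -> 0 < lp g ->
  `|\int[mu]_x (cdot (g x) (duality_fun f x)) - \int[mu]_x (cdot (g x) (duality_fun f' x))|
  <= 6 * (1 + r) * (lp f `^ r * lp (f - f') * lp g).
Proof.
move=> f0 f'f ff' g0.
have [i1 _] := cdot_hoelder g (duality_fun f).
have [i2 _] := cdot_hoelder g (duality_fun f').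
rewrite -RintegralB//.
have int : mu.-integrable setT (EFin \o (fun x =>
    cdot (g x) (duality_fun f x) - cdot (g x) (duality_fun f' x))).
  rewrite (_ : EFin \o _ = ((EFin \o (fun x => cdot (g x) (duality_fun f x))) \-
    (EFin \o (fun x => cdot (g x) (duality_fun f' x))))%E)//; exact: integrableB.
have /integrableP[mint _] := int.
rewrite -lee_fin EFin_normr_Rintegral//.
apply: le_trans (le_abse_integral _ _ _) _ => //.
have r1 : 0 <= 1 + r by rewrite addr_ge0.
apply: (@le_trans _ _ (\int[mu]_x ((1 + r)%:E *
    ((mul3 f (f - f') g x)%:E + (mul3 f' (f - f') g x)%:E)))%E).
  apply: ge0_le_integral => //.
  - exact: measurableT_comp.
  - by apply: measurable_funeM; exact: emeasurable_funD.
  - move=> x _; rewrite -EFinD -EFinM lee_fin.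
    have -> : cdot (g x) (duality_fun f x) - cdot (g x) (duality_fun f' x) =
        cdot (g x) (radial r (f x) - radial r (f' x)).
      by rewrite cdotBr.
    apply: le_trans (abs_cdot_le _ _) _.
    apply: le_trans (ler_wpM2l (rnorm_ge0 _) (radial_lipschitz _ _ r0)) _.
    rewrite /mul3 -[(f - f' : cLfunType mu p1) x]/(f x - f' x).
    by rewrite le_eqVlt; apply/orP; left; apply/eqP; ring.
rewrite ge0_integralZl_EFin//; last 2 first.
- by move=> x _; rewrite -EFinD lee_fin addr_ge0 ?mul3_ge0.
- exact: emeasurable_funD.
rewrite ge0_integralD//; try by move=> x _; rewrite lee_fin mul3_ge0.
rewrite (_ : 6 * (1 + r) * _ = (1 + r) * (3 * (lp f `^ r * lp (f - f') * lp g) +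
  3 * (lp f `^ r * lp (f - f') * lp g))); last by ring.
rewrite [leRHS]EFinM; apply: lee_wpmul2l; first by rewrite lee_fin.
by rewrite [leRHS]EFinD; apply: leeD; apply: integral_mul3_le.
Qed.

Lemma duality_map_lipschitz u u' v :
  `|pairing v (duality_map u) - pairing v (duality_map u')| <=
  (7 * (p - 1)) * rnorm (u - u') * rnorm v.
Proof.
wlog uu' : u u' / rnorm u' <= rnorm u => [H|].
  have [le|/ltW le] := leP (rnorm u') (rnorm u); first exact: H.
  by rewrite distrC rnorm_distC; exact: H.
have c1 : 1 <= 7 * (p - 1).
  have p11 : 1 <= p - 1 by rewrite lerBrDr.
  by apply: (le_trans p11); rewrite ler_peMl ?(le_trans ler01)// (ler_nat _ 1).
have J_le w : `|pairing v (duality_map w)| <= rnorm w * rnorm v.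
  apply: le_trans (pairing_le _ _) _; rewrite mulrC; apply: ler_wpM2r.
    exact: rnorm_ge0.
  exact: rnorm_duality_map.
have v0 := rnorm_ge0 v.
have d0 := rnorm_ge0 (u - u').
have [/rnorm0_eq0 ->|v1] := eqVneq (rnorm v) 0.
  have p0v w : pairing 0 w = 0.
    apply/eqP; rewrite -normr_le0; apply: le_trans (pairing_le _ _) _.
    by rewrite rnorm0 mul0r.
  by rewrite !p0v subrr normr0 rnorm0 mulr0.
have [/rnorm0_eq0/eqP|d1] := eqVneq (rnorm (u - u')) 0.
  by rewrite subr_eq0 => /eqP ->; rewrite !subrr normr0 rnorm0 mulr0 mul0r.
have [u'0|u'1] := eqVneq (rnorm u') 0.
  have := J_le u'; rewrite u'0 mul0r normr_le0 => /eqP ->.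
  rewrite (rnorm0_eq0 u'0) !subr0; apply: le_trans (J_le u) _.
  by apply: ler_wpM2r => //; rewrite ler_peMl// rnorm_ge0.
have n'0 : 0 < rnorm u' by rewrite lt_neqAle eq_sym u'1 rnorm_ge0.
have n0 : 0 < rnorm u by apply: lt_le_trans uu'.
have lr (w : cLspace mu p1) : lp (repr w) = rnorm w by rewrite lpE reprK.
have lB : lp (repr u - repr u') = rnorm (u - u').
  rewrite lpE; congr rnorm; rewrite -[in RHS](reprK u) -[in RHS](reprK u').
  by rewrite !piE.
pose I (w : cLspace mu p1) :=
  \int[mu]_x (cdot ((repr v : cLfunType mu p1) x) (duality_fun (repr w) x)).
have JE (w : cLspace mu p1) : pairing v (duality_map w) = rnorm w `^ (- r) * I w.
  rewrite /duality_map pairingZr (_ : 2 - p = - r); last by rewrite /r opprB.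
  by congr (_ * _); rewrite -{1}(reprK v) pairing_pi.
have dI : `|I u - I u'| <= 6 * (1 + r) * (rnorm u `^ r * rnorm (u - u') * rnorm v).
  have := @duality_fun_lipschitz (repr u) (repr u') (repr v).
  rewrite !lr lB; apply => //; rewrite lt_neqAle eq_sym ?d1 ?v1 ?d0 ?v0//.
have P0 : 0 < rnorm u `^ r by exact: powR_gt0.
have P'0 : 0 < rnorm u' `^ r by exact: powR_gt0.
have IE : I u' = rnorm u' `^ r * pairing v (duality_map u').
  by rewrite JE powRN mulVKf// gt_eqF.
(* The variation of I is separated from that of the norm factor. The prefactor cancels the power of
   |u| in [dI]; the two parts cost 6 (1 + r) and r, in total at most 7 (1 + r) = 7 (p - 1). *)
have -> : pairing v (duality_map u) - pairing v (duality_map u') =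
    (rnorm u `^ r)^-1 * (I u - I u') -
    (1 - (rnorm u `^ r)^-1 * rnorm u' `^ r) * pairing v (duality_map u').
  by rewrite [in LHS]JE powRN IE; ring.
apply: le_trans (ler_normB _ _) _; rewrite !normrM.
have i0 : 0 < (rnorm u `^ r)^-1 by rewrite invr_gt0.
have b1 : `|(rnorm u `^ r)^-1| * `|I u - I u'| <= 6 * (1 + r) * rnorm (u - u') * rnorm v.
  rewrite (gtr0_norm i0) ler_pdivrMl//; apply: (le_trans dI).
  by rewrite le_eqVlt; apply/orP; left; apply/eqP; ring.
have PP : rnorm u' `^ r <= rnorm u `^ r.
  by rewrite ge0_ler_powR ?nnegrE ?rnorm_ge0.
have e0 : 0 <= 1 - (rnorm u `^ r)^-1 * rnorm u' `^ r.
  by rewrite subr_ge0 ler_pdivrMl// mulr1.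
have b2 : `|1 - (rnorm u `^ r)^-1 * rnorm u' `^ r| * `|pairing v (duality_map u')| <=
    r * rnorm (u - u') * rnorm v.
  rewrite (ger0_norm e0); apply: le_trans (ler_wpM2l e0 (J_le u')) _.
  rewrite mulrA; apply: ler_wpM2r => //.
  apply: (@le_trans _ _ (r * (rnorm u - rnorm u'))).
    have := @powR_sub_le R r (rnorm u') (rnorm u) r0.
    rewrite n'0 uu' => /(_ isT) h.
    rewrite -(ler_pM2l P0); apply: le_trans (le_trans h _).
      by rewrite mulrA mulrBr mulr1 mulrA mulfV ?gt_eqF// mul1r.
    by rewrite le_eqVlt; apply/orP; left; apply/eqP; ring.
  apply: ler_wpM2l => //; rewrite lerBlDr.
  by have := rnormD (u - u') u'; rewrite subrK.
apply: le_trans (lerD b1 b2) _; rewrite -mulrDl -mulrDl.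
apply: ler_wpM2r => //; apply: ler_wpM2r => //.
rewrite [leRHS](_ : _ = 6 * (1 + r) + (1 + r)); last by rewrite /r; ring.
by rewrite lerD2l lerDr.
Qed.

Lemma smooth_duality_map :
  smooth_duality (fun u v => pairing v (duality_map u)) (7 * (p - 1)).
Proof.
split.
- by move=> u v w; rewrite pairingDl.
- exact: pairing_duality_map.
- move=> u v; apply: le_trans (ler_norm _) _; apply: le_trans (pairing_le _ _) _.
  rewrite mulrC; apply: ler_wpM2r; first exact: rnorm_ge0.
  exact: rnorm_duality_map.
- exact: duality_map_lipschitz.
Qed.

End two_le.

End conjugate.
End cLspace_pairing.

(** * Kreiss bounded operators *)

Section kreiss.
Context {R : realType} {V : normedModType R[i]} (T : {linear V -> V}).

(** The inverse at lambda = z^-1 sends z^-1 x - T x back to x. Passing to C + 1 covers z = 0, where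
    the constant must be at least 1. *)
Lemma kreiss_resolvent_lower_bound : kreiss_bounded T ->
  exists2 C : R, 0 <= C & forall (z : R[i]) (x : V), rnorm z < 1 ->
    (1 - rnorm z) * rnorm x <= C * rnorm (x - z *: T x).
Proof.
move=> [C C0 kC]; exists (C + 1); first by rewrite addr_ge0// ltW.
move=> z x z1; have [->|z0] := eqVneq z 0.
  rewrite rnorm0 scale0r !subr0 mul1r ler_peMl ?rnorm_ge0//.
  by rewrite lerDr ltW.
have nz0 : 0 < rnorm z.
  by rewrite lt_neqAle rnorm_ge0 andbT eq_sym; apply: contra z0 => /eqP/rnorm0_eq0/eqP.
have nzV : rnorm z^-1 = (rnorm z)^-1.
  apply: (mulfI (x := rnorm z)); first by rewrite gt_eqF.
  by rewrite -rnormM mulfV// rnorm1 mulfV// gt_eqF.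
have zV1 : 1 < rnorm z^-1 by rewrite nzV invf_gt1.
have [S [bS SK _ nS]] := kC _ zV1.
have := op_norm_ub bS (z^-1 *: x - T x); rewrite SK => b.
have e : z^-1 *: x - T x = z^-1 *: (x - z *: T x).
  by rewrite scalerBr scalerA mulVf// scale1r.
have {}b := le_trans b (ler_wpM2r (rnorm_ge0 _) nS).
rewrite e rnormZ nzV in b.
have d0 : 0 < 1 - rnorm z by rewrite subr_gt0.
have C' : C / ((rnorm z)^-1 - 1) * ((rnorm z)^-1 * rnorm (x - z *: T x)) =
    (1 - rnorm z)^-1 * (C * rnorm (x - z *: T x)).
  by field; rewrite !gt_eqF// subr_gt0 invf_gt1.
rewrite C' in b; move: b; rewrite ler_pdivlMl// => b; apply: (le_trans b).
by apply: ler_wpM2r; [exact: rnorm_ge0|rewrite lerDl].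
Qed.

Lemma bounded_op_ge0 : bounded_op T ->
  exists2 t : R, 0 <= t & forall x, rnorm (T x) <= t * rnorm x.
Proof.
move=> [M TM]; exists `|M| => // x; apply: le_trans (TM x) _.
by apply: ler_wpM2r; [exact: rnorm_ge0|exact: ler_norm].
Qed.

Section period.
Context (t C : R).
Hypothesis t0 : 0 <= t.
Hypothesis Tt : forall x, rnorm (T x) <= t * rnorm x.
Hypothesis C0 : 0 <= C.
Hypothesis TC : forall (z : R[i]) x, rnorm z < 1 ->
  (1 - rnorm z) * rnorm x <= C * rnorm (x - z *: T x).

Let exists_period L N : (0 < N)%N ->
  exists K1, [/\ (0 < K1)%N, (N < 2 ^ (L + 7) * K1)%N & forall x,
    disk_radius N ^+ (2 ^ (L + 7) * K1) * rnorm (iter (2 ^ (L + 7) * K1) T x) <= rnorm x].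
Proof.
move=> N0; have [K0 hK] := power_decay t0 Tt C0 TC (@radius01 R N N0).
have e0 : (0 < 2 ^ (L + 7))%N by rewrite expn_gt0.
exists (K0 + N).+1; split=> //; first by nia.
by apply: hK; nia.
Qed.

Lemma smooth_power_bound (J : V -> V -> R) (c : R) : 0 <= c -> smooth_duality J c ->
  exists2 D : R, 0 <= D & forall L N x, (0 < L)%N -> (2 ^ L.+1 <= N)%N ->
    Num.sqrt L%:R * rnorm (iter N T x) <= D * N%:R * rnorm x.
Proof.
move=> c0 JP; exists (128 * C * (2 * C + 32 * C ^+ 2 * t) * Num.sqrt (8 * c)).
  have tC : 0 <= 32 * C ^+ 2 * t by rewrite !mulr_ge0// sqr_ge0.
  by rewrite !mulr_ge0 ?sqrtr_ge0// addr_ge0// mulr_ge0.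
move=> L N x L0 LN.
have N0 : (0 < N)%N by apply: leq_trans LN; rewrite expn_gt0.
have [K1 [K10 NK dec]] := exists_period L N0.
exact: (smooth_power_bound_period t0 Tt C0 TC K10 LN NK dec c0 JP L0).
Qed.

Lemma dual_power_bound (Y : normedModType R[i]) (beta : V -> Y -> R) (nu : V -> Y)
    (J : Y -> Y -> R) (c : R) :
    0 <= c -> smooth_duality J c -> norming_pairing beta nu ->
  exists2 D : R, 0 <= D & forall L N x, (0 < L)%N -> (2 ^ L.+1 <= N)%N ->
    Num.sqrt L%:R * rnorm (iter N T x) <= D * N%:R * rnorm x.
Proof.
move=> c0 JP bP; exists ((128 * C) ^+ 2 * Num.sqrt (8 * c)).
  by rewrite !mulr_ge0 ?sqrtr_ge0 ?sqr_ge0.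
move=> L N x L0 LN.
have N0 : (0 < N)%N by apply: leq_trans LN; rewrite expn_gt0.
have [K1 [K10 NK dec]] := exists_period L N0.
exact: (dual_power_bound_period t0 C0 TC K10 LN NK dec c0 JP bP L0).
Qed.

End period.

Lemma op_norm_iter_le N (B : R) : (forall x, rnorm (iter N T x) <= B * rnorm x) ->
  0 <= B -> `|op_norm (iter N T)| <= B.
Proof.
move=> TB B0.
have ub : ubound [set rnorm (iter N T x) | x in [set x : V | rnorm x <= 1]] B.
  move=> _ [x /= x1 <-]; apply: le_trans (TB x) _.
  by rewrite ler_piMr.
have ne : [set rnorm (iter N T x) | x in [set x : V | rnorm x <= 1]]
    (rnorm (iter N T 0)) by exists 0 => //=; rewrite rnorm0.
rewrite ger0_norm; first by apply: ge_sup => //; eexists; exact: ne.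
apply: le_trans (rnorm_ge0 (iter N T 0)) _.
by apply: ub_le_sup => //; exists B.
Qed.

Lemma power_bound_bigO (D : R) : 0 <= D ->
    (forall L N x, (0 < L)%N -> (2 ^ L.+1 <= N)%N ->
      Num.sqrt L%:R * rnorm (iter N T x) <= D * N%:R * rnorm x) ->
  (fun n : nat => op_norm (iter n T)) =O_\oo
    (fun n : nat => n%:R / Num.sqrt (ln n%:R)).
Proof.
move=> D0 TD; apply/eqO_exP; exists (Num.sqrt 3 * D + 1).
  by rewrite ltr_wpDl// mulr_ge0// sqrtr_ge0.
exists 4%N => // N /= N4.
(* The largest L with 2^(L + 1) <= N, positive because N >= 4; then ln N <= (L + 2) ln 2 <= 3 L. *)
pose L := (trunc_log 2 N).-1.
have N0 : (0 < N)%N by lia.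
have /andP[lN Nl] := trunc_log_bounds (isT : 1 < 2)%N N0.
have l2 : (2 <= trunc_log 2 N)%N by rewrite trunc_log_max.
have L0 : (0 < L)%N by rewrite /L; lia.
have LE : trunc_log 2 N = L.+1 by rewrite /L; lia.
rewrite LE in lN Nl.
have N0' : 0 < N%:R :> R by rewrite ltr0n.
have Lp : 0 < Num.sqrt L%:R :> R by rewrite sqrtr_gt0 ltr0n.
have lnN0 : 0 < ln N%:R :> R by rewrite ln_gt0// (ltr_nat R 1); lia.
have lnN : ln N%:R <= 3 * L%:R :> R.
  have h : ln N%:R <= ln (2 ^+ L.+2) :> R.
    by rewrite ler_ln ?posrE ?exprn_gt0// -natrX ler_nat ltnW.
  apply: (le_trans h); rewrite lnXn// -[leLHS]mulr_natr.
  have ln2 : ln 2 <= 1 :> R.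
    have := @le_ln1Dx R 1; rewrite (_ : 1 + 1 = 2 :> R)//; apply; lra.
  have L1 : 1 <= L%:R :> R by rewrite (ler_nat R 1).
  have L2 : L.+2%:R = L%:R + 2 :> R by rewrite -addn2 natrD.
  rewrite L2; apply: (@le_trans _ _ (1 * (L%:R + 2))); last by lra.
  by apply: ler_wpM2r => //; lra.
have sle : Num.sqrt (ln N%:R) <= Num.sqrt 3 * Num.sqrt L%:R :> R.
  by rewrite -sqrtrM// ler_wsqrtr.
have s0 : 0 < Num.sqrt (ln N%:R) :> R by rewrite sqrtr_gt0.
rewrite [X in _ <= _ * X]ger0_norm; last by rewrite divr_ge0// ltW.
apply: op_norm_iter_le => [x|]; last first.
  by rewrite mulr_ge0 ?divr_ge0 ?(ltW s0)// addr_ge0// mulr_ge0// sqrtr_ge0.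
rewrite -(ler_pM2l s0).
have y0 := rnorm_ge0 (iter N T x); have x0 := rnorm_ge0 x.
apply: le_trans (ler_wpM2r y0 sle) _; rewrite -mulrA.
apply: le_trans (ler_wpM2l (sqrtr_ge0 3) (TD L N x L0 lN)) _.
rewrite [leRHS](_ : _ = (Num.sqrt 3 * D + 1) * N%:R * rnorm x); last first.
  by field; rewrite gt_eqF.
have : 0 <= N%:R * rnorm x by rewrite mulr_ge0.
lra.
Qed.

End kreiss.

Theorem corollary3p2 (R : realType) (d : measure_display)
    (Omega : measurableType d) (mu : {measure set Omega -> \bar R})
    (p : R) (p1 : 1 < p)
    (T : {linear cLspace mu (ltW p1) -> cLspace mu (ltW p1)}) :
  bounded_op T -> kreiss_bounded T ->
  (fun n : nat => op_norm (iter n T)) =O_\oo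
    (fun n : nat => n%:R / Num.sqrt (ln n%:R)).
Proof.
move=> /bounded_op_ge0[t t0 Tt] /kreiss_resolvent_lower_bound[C C0 TC].
pose q := p / (p - 1).
have pp : 0 < p - 1 by rewrite subr_gt0.
have p0 : 0 < p := lt_trans ltr01 p1.
have q1 : 1 < q by rewrite ltr_pdivlMr// mul1r gtrBl.
have pq : p^-1 + q^-1 = 1 by rewrite /q; field; rewrite !gt_eqF.
suff [D D0 TD] : exists2 D : R, 0 <= D & forall L N x, (0 < L)%N -> (2 ^ L.+1 <= N)%N ->
    Num.sqrt L%:R * rnorm (iter N T x) <= D * N%:R * rnorm x.
  exact: power_bound_bigO D0 TD.
have [p2|/ltW p2] := leP 2 p.
  have c0 : 0 <= 7 * (p - 1) by rewrite mulr_ge0// ltW.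
  exact: smooth_power_bound t0 Tt C0 TC _ _ c0
    (smooth_duality_map mu (ltW p1) (ltW q1) p1 pq p2).
(* For p < 2 smoothness comes from L^q, whose duality map takes values in L^p: the exponents are
   exchanged in [smooth_duality_map] but not in [pairing_norming]. *)
have q2 : 2 <= q by rewrite ler_pdivlMr// mulrBr mulr1 lerBlDr mulr_natl mulr2n lerD2l.
have qp : q^-1 + p^-1 = 1 by rewrite addrC.
have c0 : 0 <= 7 * (q - 1) by rewrite mulr_ge0// subr_ge0 ltW.
exact: dual_power_bound t0 Tt C0 TC _ _ _ _ _ c0
  (smooth_duality_map mu (ltW q1) (ltW p1) q1 qp q2)
  (pairing_norming mu (ltW p1) (ltW q1) p1 pq).
Qed.
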